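(* Let $n\in\{3,4\}$ and let $M(\mathcal{C},\lambda)$ be an irreducible Yetter-Drinfeld module over $\mathbb{S}_n$ such that the Nichols algebra $\mathfrak{B}(\mathcal{C},\lambda)$ is finite-dimensional. (i) If $n=3$, then $M(\mathcal{C},\lambda)\simeq M(\mathcal{O}_2,\operatorname{sgn})$. (ii) If $n=4$, then $M(\mathcal{C},\lambda)$ is isomorphic either to $M(\mathcal{O}_4,\chi_4^2)$, or to $M(\mathcal{O}_2,\operatorname{sgn}\oplus\varepsilon)$, or to $M(\mathcal{O}_2,\operatorname{sgn}\oplus\operatorname{sgn})$.
   Context: All vector spaces and representations are over $\mathbb{C}$. $\mathbb{S}_n$ is the symmetric group on $\{1,\dots,n\}$. Yetter-Drinfeld modules: for a finite group $G$, a Yetter-Drinfeld module over $G$ is a $G$-graded vector space $M=\oplus_{h\in G}M_h$ with a linear $G$-action such that $g\cdot M_h\subseteq M_{ghg^{-1}}$. It is a braided vector space with $c(x\otimes y)=(h\cdot y)\otimes x$ for $x\in M_h$, $y\in M$. For a conjugacy class $\mathcal{C}$ of $G$, a fixed $s\in\mathcal{C}$ with centralizer $G^s$, and an irreducible representation $\rho$ of $G^s$ on $V$, the irreducible Yetter-Drinfeld module $M(\mathcal{C},\rho)$ is defined as follows. Enumerate $\mathcal{C}=\{t_1=s,\dots,t_M\}$ and choose $g_i\in G$ with $g_isg_i^{-1}=t_i$. Then $M(\mathcal{C},\rho)=\oplus_{1\le i\le M}\, g_i\otimes V$, where $g_iv:=g_i\otimes v$ has degree $t_i$, and $g\cdot(g_iv)=g_j(\rho(\gamma)v)$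 where $gg_i=g_j\gamma$ with $\gamma\in G^s$. Every irreducible Yetter-Drinfeld module over $G$ is isomorphic to one of these, and irreducible ones are parameterized by pairs $(\mathcal{C},\rho)$. Nichols algebras: for a braided vector space $(V,c)$, put $c_i=\mathrm{id}^{\otimes(i-1)}\otimes c\otimes\mathrm{id}^{\otimes(m-i-1)}$ on $V^{\otimes m}$. For $w\in\mathbb{S}_m$ with reduced expression $w=s_{i_1}\cdots s_{i_k}$ in the simple transpositions $s_i=(i\ i+1)$ put $c_w=c_{i_1}\cdots c_{i_k}$ (well defined by the braid equation). The Nichols algebra is $\mathfrak{B}(V)=\oplus_{m\ge0}V^{\otimes m}/\ker\big(\sum_{w\in\mathbb{S}_m}c_w\big)$, a quotient algebra of the tensor algebra $T(V)$. One writes $\mathfrak{B}(\mathcal{C},\rho):=\mathfrak{B}(M(\mathcal{C},\rho))$. Orbits and characters: $\mathcal{O}_j$ is the conjugacy class of $j$-cycles in $\mathbb{S}_n$. For $\mathcal{O}_2$ in $\mathbb{S}_3$, take $s=(12)$, with centralizer $\langle(12)\rangle\simeq\mathbb{Z}/2$, and $\operatorname{sgn}$ is its nontrivial character. For $\mathcal{O}_4$ in $\mathbb{S}_4$, take $s=\tau_4=(1234)$, with centralizer $\langle\tau_4\rangle\simeq\mathbb{Z}/4$; $\chi_4$ is the character with $\chi_4(\tau_4)=\omega_4$, a fixed primitive 4th root of 1, so $\chi_4^2(\tau_4)=-1$. For $\mathcal{O}_2$ in $\mathbb{S}_4$, take $s=(12)$, with centralizer $\langle(12)\rangle\times\langle(34)\rangle\simeq\mathbb{Z}/2\oplus\mathbb{Z}/2$;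 $\alpha\oplus\beta$ denotes the one-dimensional character whose restriction to $\langle(12)\rangle$ is $\alpha$ and whose restriction to $\langle(34)\rangle$ is $\beta$, where $\varepsilon$ is the trivial character and $\operatorname{sgn}$ the nontrivial (sign) character. *)

(* Defs.v *)
From HB Require Import structures.
From mathcomp Require Import all_boot all_order all_algebra all_fingroup all_solvable.
From mathcomp Require Import mxrepresentation.
From mathcomp Require Import complex.
From mathcomp Require Import ring.
From mathcomp Require Import boolp classical_sets reals.

Set Implicit Arguments.
Unset Strict Implicit.
Unset Printing Implicit Defensive.

Import GRing.Theory.
Local Open Scope ring_scope.

(* Conventions.  In MathComp the product s * t of two permutations is "first s,
   then t", and matrix representations act on row vectors from the right.  We
   follow both: all modules are right modules, so that x . (g * h) =
   (x . g) . h.  For G = 'S_n this is exactly the usual notion of left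
   S_n-module, S_n being equipped with composition of functions; every product
   in the textbook formulas is read in the opposite order, and g h g^-1 becomes
   h ^ g = g^-1 * h * g. *)

Section TensorPowers.
Variables (F : fieldType) (V : vectType F).

Local Notation d := (\dim {:V}).

(* An element of V^{(x) m} is the array of its coordinates in the basis
   e_{a 0} (x) ... (x) e_{a (m-1)}, where e = vbasis {:V}. *)
Definition tpow (m : nat) : vectType F := {ffun {ffun 'I_m -> 'I_d} -> F^o}.

Definition tens m (v : 'I_m -> V) : tpow m :=
  [ffun a : {ffun 'I_m -> 'I_d} => \prod_(i < m) coord (vbasis {:V}) (a i) (v i)].

Definition tens2 (x y : V) : tpow 2 :=
  tens (fun i : 'I_2 => if i == ord0 then x else y).

(* The positions i and i + 1 moved by the i-th simple transposition of S_m. *)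
Definition posl m (i : 'I_m.-1) : 'I_m := widen_ord (leq_pred m) i.
Lemma posr_subproof m (i : 'I_m.-1) : (i.+1 < m)%N.
Proof. by rewrite -ltn_predRL. Qed.
Definition posr m (i : 'I_m.-1) : 'I_m := Ordinal (posr_subproof i).

Variable c : tpow 2 -> tpow 2.

(* id (x) ... (x) c (x) ... (x) id, with c on the tensor factors i and i + 1:
   [legs i a x] is the element of V (x) V obtained from x by freezing all
   indices except those at positions i and i + 1 to their values in a. *)
Definition legs m (i : 'I_m.-1) (a : {ffun 'I_m -> 'I_d}) (x : tpow m) : tpow 2 :=
  [ffun b : {ffun 'I_2 -> 'I_d} =>
     x [ffun j => if j == posl i then b ord0
                  else if j == posr i then b ord_max else a j]].

Definition braid_at m (i : 'I_m.-1) (x : tpow m) : tpow m :=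
  [ffun a : {ffun 'I_m -> 'I_d} =>
     c (legs i a x) [ffun j : 'I_2 => if j == ord0 then a (posl i) else a (posr i)]].

Definition simple_transp m (i : 'I_m.-1) : 'S_m := tperm (posl i) (posr i).

Definition is_reduced_expr m (w : 'S_m) (ks : seq 'I_m.-1) : Prop :=
  w = (\prod_(k <- ks) simple_transp k)%g /\
  forall ls, w = (\prod_(l <- ls) simple_transp l)%g -> (size ks <= size ls)%N.

Definition reduced_expr m (w : 'S_m) : seq 'I_m.-1 :=
  xget [::] [set ks | is_reduced_expr w ks]%classic.

Lemma tperm_simple_expr m k (i j : 'I_m) : j = (i + k)%N :> nat ->
  exists ks, tperm i j = (\prod_(k <- ks) simple_transp k)%g.
Proof.
elim: k j => [|k IHk] j jE.
  exists [::]; rewrite big_nil (_ : j = i) ?tperm1 //.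
  by apply: val_inj; rewrite /= jE addn0.
have jk : (i + k < m.-1)%N by rewrite ltn_predRL -addnS -jE.
pose l : 'I_m.-1 := Ordinal jk.
have jl : j = posr l by apply: val_inj; rewrite /= jE addnS.
have [ks ksE] := IHk (posl l) erefl.
have [k0|k0] := posnP k.
  exists [:: l]; rewrite big_seq1 /simple_transp jl; congr tperm.
  by apply: val_inj; rewrite /= k0 addn0.
have -> : tperm i j = (tperm i (posl l) ^ simple_transp l)%g.
  rewrite tpermJ tpermL tpermD -?jl // -val_eqE /= ?jE.
    by rewrite -{2}[val i]addn0 eqn_add2l -lt0n.
  by rewrite -{2}[val i]addn0 eqn_add2l.
exists (l :: ks ++ [:: l]).
by rewrite conjgE /simple_transp tpermV ksE big_cons big_cat big_seq1.
Qed.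

Lemma reduced_exprP m (w : 'S_m) : is_reduced_expr w (reduced_expr w).
Proof.
apply: xgetPex.
have [ls lsE] : exists ls, w = (\prod_(l <- ls) simple_transp l)%g.
  have [ts -> _] := prod_tpermP w.
  elim: ts => [|[i j] ts [ls IH]]; first by exists [::]; rewrite !big_nil.
  have [ks ksE] : exists ks, tperm i j = (\prod_(k <- ks) simple_transp k)%g.
    have [ij|/ltnW ij] := leqP i j; last rewrite tpermC.
      by apply: (@tperm_simple_expr _ (j - i)); rewrite subnKC.
    by apply: (@tperm_simple_expr _ (i - j)); rewrite subnKC.
  by exists (ks ++ ls); rewrite big_cons big_cat /= -IH -ksE.
pose Q n := [exists ks : n.-tuple 'I_m.-1, w == (\prod_(k <- ks) simple_transp k)%g].
have exQ : exists n, Q n.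
  by exists (size ls); apply/existsP; exists (in_tuple ls); rewrite /= -lsE.
case: (ex_minnP exQ) => n /existsP[ks /eqP ksE] n_min.
exists (tval ks); split=> // l lE; rewrite size_tuple; apply: n_min.
by apply/existsP; exists (in_tuple l); rewrite /= -lE.
Qed.

Definition braid_perm m (w : 'S_m) (x : tpow m) : tpow m :=
  foldl (fun y i => braid_at i y) x (reduced_expr w).

Definition quantum_symmetrizer m (x : tpow m) : tpow m :=
  \sum_(w : 'S_m) braid_perm w x.

(* The tensor algebra T(V): finitely supported families of tensors. *)
Record tensor_algebra := TensorAlgebra {
  component :> forall m, tpow m;
  _ : exists N, forall m, (N <= m)%N -> component m = 0 }.

(* x and y have the same class in the Nichols algebra
   B(V) = \bigoplus_m V^{(x) m} / ker (quantum_symmetrizer m). *)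
Definition nichols_eq (x y : forall m, tpow m) : Prop :=
  forall m, quantum_symmetrizer (x m - y m) = 0.

(* dim B(V) < oo: B(V) is spanned by the classes of finitely many elements. *)
Definition nichols_finite_dim : Prop :=
  exists (r : nat) (b : 'I_r -> tensor_algebra),
    forall x : tensor_algebra, exists a : 'I_r -> F,
      nichols_eq x (fun m => \sum_(k < r) a k *: (b k m : tpow m)).

End TensorPowers.

Record yd_module (F : fieldType) (gT : finGroupType) (V : vectType F) :=
  YDModule {
    yd_act : gT -> 'End(V);
    yd_comp : gT -> {vspace V};
    yd_act1 : yd_act 1%g = \1%VF;
    yd_actM : forall g h, yd_act (g * h)%g = (yd_act h \o yd_act g)%VF;
    yd_direct : directv (\sum_h yd_comp h);
    yd_full : (\sum_h yd_comp h)%VS = fullv;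
    yd_compat : forall g h, (yd_act g @: yd_comp h <= yd_comp (h ^ g)%g)%VS }.

Section YetterDrinfeld.
Variables (F : fieldType) (gT : finGroupType).

Definition yd_iso (V W : vectType F) (M : yd_module gT V) (N : yd_module gT W) : Prop :=
  exists f : 'Hom(V, W),
    [/\ bijective f,
        forall g, (f \o yd_act M g)%VF = (yd_act N g \o f)%VF
      & forall h, (f @: yd_comp M h <= yd_comp N h)%VS].

Section Braiding.
Variables (V : vectType F) (M : yd_module gT V).

Definition yd_proj (h : gT) : 'End(V) := sumv_pi (\sum_h' yd_comp M h')%VS h.

(* The braiding x (x) y |-> \sum_h (y . h) (x) x_h, extended linearly from the
   basis tensors e_k (x) e_l. *)
Definition yd_braiding (t : tpow V 2) : tpow V 2 :=
  \sum_(b : {ffun 'I_2 -> 'I_(\dim {:V})})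
    t b *: \sum_(h : gT) tens2 (yd_act M h (vbasis {:V})`_(b ord_max))
                               (yd_proj h (vbasis {:V})`_(b ord0)).

Lemma tens2E (x y : V) b : tens2 x y b =
  coord (vbasis {:V}) (b ord0) x * coord (vbasis {:V}) (b ord_max) y.
Proof.
rewrite ffunE big_ord_recl big_ord1 /=.
by rewrite (_ : lift ord0 ord0 = ord_max) //; apply: val_inj.
Qed.

Lemma yd_projE h x h' :
  x \in yd_comp M h -> yd_proj h' x = if h' == h then x else 0.
Proof.
move=> xh.
have sx : \sum_g yd_proj g x = x.
  by apply: sumv_pi_sum => //; rewrite yd_full memvf.
have px g : yd_proj g x \in yd_comp M g by apply: memv_sum_pi.
have yx g : (if g == h then x else 0) \in yd_comp M g.
  by case: eqP => [->|_]; rewrite ?mem0v.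
have := directv_sum_unique (yd_direct M) _ _ (fun g _ => px g) (fun g _ => yx g).
rewrite /= sx -big_mkcond big_pred1_eq eqxx => /esym/forallP/(_ h').
by move=> /eqP.
Qed.

Lemma yd_braidingE h x y :
  x \in yd_comp M h -> yd_braiding (tens2 x y) = tens2 (yd_act M h y) x.
Proof.
move=> xh; apply/ffunP => b'; rewrite sum_ffunE.
pose e := vbasis {:V}.
have ee v : v = \sum_i coord e i v *: e`_i.
  by apply: coord_vbasis; rewrite memvf.
have decomp (f : 'End(V)) i v :
    coord e i (f v) = \sum_j coord e j v * coord e i (f e`_j).
  rewrite {1}[v]ee !linear_sum; apply: eq_bigr => j _.
  by rewrite !linearZ.
transitivity (\sum_(g : gT) tens2 (yd_act M g y) (yd_proj g x) b'); last first.
  rewrite (bigD1 h) //= (yd_projE _ xh) eqxx big1 ?addr0 // => g gh.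
  by rewrite (yd_projE _ xh) (negbTE gh) tens2E linear0 mulr0.
have scaleE (a : F) (t : tpow V 2) b : (a *: t) b = a * t b by rewrite ffunE.
under eq_bigr => b _ do rewrite scaleE sum_ffunE mulr_sumr tens2E.
rewrite exchange_big /=; apply: eq_bigr => g _.
pose E (i : 'I_2) j := if i == ord0
  then coord e j x * coord e (b' ord_max) (yd_proj g e`_j)
  else coord e j y * coord e (b' ord0) (yd_act M g e`_j).
transitivity (\prod_(i < 2) \sum_j E i j).
  rewrite bigA_distr_bigA /=; apply: eq_bigr => b _.
  rewrite big_ord_recl big_ord1 /E /= tens2E -/e.
  rewrite (_ : lift ord0 ord0 = ord_max); last exact: val_inj.
  ring.
rewrite big_ord_recl big_ord1 tens2E (decomp _ _ x) (decomp _ _ y) /E /=.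
by rewrite mulrC.
Qed.

End Braiding.

Section IrreducibleYD.
Variables (s : gT) (d : nat) (rho : mx_representation F 'C[s]%G d).

Definition conj_class : finType := {t : gT | t \in (s ^: [set: gT])%g}.

(* The chosen g_t with s ^ g_t = t. *)
Definition conj_elt (t : conj_class) : gT := repr [set g : gT | (s ^ g)%g == val t].

Lemma conj_act_subproof (t : conj_class) g : ((val t) ^ g \in s ^: [set: gT])%g.
Proof.
case: t => t /= /imsetP[x _ ->].
by rewrite -conjgM memJ_class ?inE.
Qed.
Definition conj_act (t : conj_class) g : conj_class :=
  exist _ (val t ^ g)%g (conj_act_subproof t g).

(* The gamma in the centralizer of s with g_t * g = gamma * g_(t ^ g). *)
Definition conj_cocycle (t : conj_class) (g : gT) : gT :=
  (conj_elt t * g * (conj_elt (conj_act t g))^-1)%g.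

(* The underlying space \bigoplus_(t in C) g_t (x) V; [yd_elt t v] is g_t v. *)
Definition yd_space : vectType F := {ffun conj_class -> 'rV[F]_d}.

Definition yd_elt (t : conj_class) (v : 'rV[F]_d) : yd_space :=
  [ffun u => if u == t then v else 0].

Definition yd_irr_act_fun (g : gT) (f : yd_space) : yd_space :=
  \sum_(t : conj_class) yd_elt (conj_act t g) (f t *m rho (conj_cocycle t g)).

Definition yd_irr_act (g : gT) : 'End(yd_space) := linfun (yd_irr_act_fun g).

Definition yd_irr_comp (h : gT) : {vspace yd_space} :=
  (\sum_(t : conj_class | val t == h) limg (linfun (yd_elt t)))%VS.

Lemma conj_eltP t : (s ^ conj_elt t)%g = val t.
Proof.
case: t => t ht; rewrite /conj_elt /=.
have /imsetP[x _ xt] := ht.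
have : x \in [set g : gT | (s ^ g)%g == t] by rewrite inE xt.
by move/mem_repr; rewrite inE => /eqP.
Qed.

Lemma conj_cocycle_cent t g : conj_cocycle t g \in 'C[s]%g.
Proof.
suff e : (s ^ conj_cocycle t g)%g = s.
  by apply/cent1P; rewrite /commute [RHS]conjgC e.
by rewrite /conj_cocycle !conjgM conj_eltP -[(val t ^ g)%g]/(val (conj_act t g)) -conj_eltP conjgK.
Qed.

Lemma yd_elt_is_linear t : linear (yd_elt t).
Proof.
move=> a u v; apply/ffunP => x; rewrite !ffunE.
by case: ifP => // _; rewrite scaler0 addr0.
Qed.
HB.instance Definition _ t :=
  GRing.isLinear.Build F 'rV[F]_d yd_space _ (yd_elt t) (yd_elt_is_linear t).

Lemma yd_irr_act_is_linear g : linear (yd_irr_act_fun g).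
Proof.
move=> a u v; rewrite /yd_irr_act_fun scaler_sumr -big_split; apply: eq_bigr => t _ /=.
by rewrite !ffunE mulmxDl -scalemxAl linearP.
Qed.
HB.instance Definition _ g :=
  GRing.isLinear.Build F yd_space yd_space _ (yd_irr_act_fun g) (yd_irr_act_is_linear g).

Lemma yd_space_sum (f : yd_space) : f = \sum_t yd_elt t (f t).
Proof.
apply/ffunP => x; rewrite sum_ffunE (bigD1 x) //= ffunE eqxx big1 ?addr0 //.
by move=> t; rewrite eq_sym ffunE => /negbTE->.
Qed.

Lemma yd_irr_act_elt g t v :
  yd_irr_act g (yd_elt t v) = yd_elt (conj_act t g) (v *m rho (conj_cocycle t g)).
Proof.
rewrite lfunE /= /yd_irr_act_fun (bigD1 t) //= ffunE eqxx big1 ?addr0 // => u.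
by rewrite ffunE => /negbTE->; rewrite mul0mx linear0.
Qed.

Lemma yd_irr_actE g (f : yd_space) :
  yd_irr_act g f = \sum_t yd_irr_act g (yd_elt t (f t)).
Proof. by rewrite {1}[f]yd_space_sum linear_sum. Qed.

Lemma yd_irr_act1 : yd_irr_act 1%g = \1%VF.
Proof.
apply/lfunP => f; rewrite yd_irr_actE id_lfunE [RHS]yd_space_sum.
apply: eq_bigr => t _; rewrite yd_irr_act_elt.
have ct : conj_act t 1%g = t by apply: val_inj; rewrite /= conjg1.
by rewrite /conj_cocycle ct mulg1 mulgV repr_mx1 mulmx1.
Qed.

Lemma yd_irr_actM g h : yd_irr_act (g * h)%g = (yd_irr_act h \o yd_irr_act g)%VF.
Proof.
apply/lfunP => f; rewrite comp_lfunE yd_irr_actE (yd_irr_actE g f).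
transitivity (\sum_t yd_irr_act h (yd_irr_act g (yd_elt t (f t)))); last first.
  by rewrite linear_sum.
apply: eq_bigr => t _.
rewrite 3!yd_irr_act_elt -mulmxA -repr_mxM ?conj_cocycle_cent //.
have ct : conj_act (conj_act t g) h = conj_act t (g * h)%g.
  by apply: val_inj; rewrite /= conjgM.
rewrite ct; congr (yd_elt _ (_ *m rho _)).
by rewrite /conj_cocycle ct !mulgA mulgKV.
Qed.

Lemma mem_yd_irr_comp h f :
  (f \in yd_irr_comp h) = [forall t : conj_class, (val t != h) ==> (f t == 0)].
Proof.
apply/idP/forallP => [/memv_sumP[us us_in ->] t | f0].
  apply/implyP => th; rewrite sum_ffunE; apply/eqP/big1 => u /eqP uh.
  have /memv_imgP[v _ ->] := us_in u (introT eqP uh).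
  by rewrite lfunE /= ffunE; case: eqP => // tu; rewrite tu uh eqxx in th.
rewrite [f]yd_space_sum (bigID (fun t : conj_class => val t == h)) /=.
rewrite [X in _ + X]big1 ?addr0 => [|t th].
  apply: memv_sumr => t th; apply/memv_imgP; exists (f t); rewrite ?memvf //.
  by rewrite lfunE.
by have /implyP/(_ th)/eqP-> := f0 t; rewrite linear0.
Qed.

(* U keeps [directv] from looking into the sums defining yd_irr_comp. *)
Lemma yd_irr_direct (U : gT -> {vspace yd_space}) :
  U = yd_irr_comp -> directv (\sum_h U h).
Proof.
move=> UE; apply/directv_sum_independent => us; rewrite {}UE.
move=> us_in us0 h _; apply/ffunP => t; rewrite ffunE.
have [th|th] := eqVneq (val t) h; last first.
  have := us_in h isT; rewrite mem_yd_irr_comp => /forallP/(_ t).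
  by rewrite th => /eqP.
have := congr1 (fun f : yd_space => f t) us0; rewrite /= sum_ffunE ffunE.
rewrite (bigD1 h) //= big1 ?addr0 // => h' h'h.
have := us_in h' isT; rewrite mem_yd_irr_comp => /forallP/(_ t).
by rewrite th eq_sym h'h => /eqP.
Qed.

Lemma yd_irr_full : (\sum_h yd_irr_comp h)%VS = fullv.
Proof.
apply/eqP; rewrite eqEsubv subvf; apply/subvP => f _.
rewrite [f]yd_space_sum; apply: memv_suml => t _.
apply: (subvP (sumv_sup (val t) _ (subvv _))) => //.
rewrite mem_yd_irr_comp; apply/forallP => u; apply/implyP => ut.
by rewrite ffunE; case: (u =P t) ut => // ->; rewrite eqxx.
Qed.

Lemma yd_irr_compat g h :
  (yd_irr_act g @: yd_irr_comp h <= yd_irr_comp (h ^ g)%g)%VS.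
Proof.
apply/subvP => _ /memv_imgP[f fh ->]; rewrite yd_irr_actE.
move: fh; rewrite mem_yd_irr_comp => /forallP fh.
apply: memv_suml => t _; rewrite yd_irr_act_elt mem_yd_irr_comp.
apply/forallP => u; apply/implyP => uh; rewrite ffunE.
case: (u =P conj_act t g) uh => // -> /=; rewrite (can_eq (conjgK g)) => th.
by have /implyP/(_ th)/eqP-> := fh t; rewrite mul0mx.
Qed.

Definition yd_irr : yd_module gT yd_space :=
  YDModule yd_irr_act1 yd_irr_actM (yd_irr_direct erefl) yd_irr_full yd_irr_compat.

Definition nichols_irr_finite_dim : Prop := nichols_finite_dim (yd_braiding yd_irr).

End IrreducibleYD.

Section LinearRepr.
Variables (G : {group gT}) (chi : gT -> F).
Hypothesis chi1 : chi 1%g = 1.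
Hypothesis chiM : {in G &, {morph chi : x y / (x * y)%g >-> x * y}}.

Lemma lin_repr_subproof : mx_repr G (fun x => (chi x)%:M : 'M[F]_1).
Proof. by split=> [|x y xG yG]; rewrite ?chi1 // chiM // scalar_mxM. Qed.

Definition lin_repr : mx_representation F G 1 := MxRepresentation lin_repr_subproof.

End LinearRepr.
End YetterDrinfeld.

(* The letters 1, ..., n are the elements 0, ..., n - 1 of 'I_n. *)
Definition s12_3 : 'S_3 := tperm 0 1.
Definition s12_4 : 'S_4 := tperm 0 1.
Definition s34_4 : 'S_4 := tperm 2%:R 3%:R.
Definition tau4 : 'S_4 := perm (@ordS_inj 4).

Section Characters.
Variable F : fieldType.

(* sgn on the centralizer <(12)> of (12) in S_3: the restriction of the
   signature. *)
Definition sgn_3 (g : 'S_3) : F := (-1) ^+ odd_perm g.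

Lemma sgn_3_1 : sgn_3 1%g = 1.
Proof. by rewrite /sgn_3 odd_perm1. Qed.

Lemma sgn_3_M : {in 'C[s12_3]%G &, {morph sgn_3 : x y / (x * y)%g >-> x * y}}.
Proof. by move=> x y _ _; rewrite /sgn_3 odd_permM signr_addb. Qed.

Lemma sgn_3_s12 : sgn_3 s12_3 = -1.
Proof. by rewrite /sgn_3 odd_tperm. Qed.

Definition rep_sgn_3 : mx_representation F 'C[s12_3]%G 1 := lin_repr sgn_3_1 sgn_3_M.

(* An element of the centralizer <(12)> x <(34)> of (12) in S_4 has component
   (12) iff it moves 1, and component (34) iff it moves 3.  [oplus_4 a b] is
   alpha (+) beta, with alpha = sgn if a and alpha = eps otherwise, and
   likewise for beta and b. *)
Definition oplus_4 (a b : bool) (g : 'S_4) : F :=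
  (-1) ^+ (a && (g 0 != 0)) * (-1) ^+ (b && (g 2%:R != 2%:R)).

Lemma oplus_4_1 a b : oplus_4 a b 1%g = 1.
Proof. by rewrite /oplus_4 !perm1 !eqxx !andbF mulr1. Qed.

Lemma cent_s12_4 (g : 'S_4) : g \in 'C[s12_4]%g ->
  [/\ (g 0 == 0) && (g 1 == 1) || (g 0 == 1) && (g 1 == 0)
    & (g 2%:R == 2%:R) && (g 3%:R == 3%:R) || (g 2%:R == 3%:R) && (g 3%:R == 2%:R)].
Proof.
move=> /cent1P cg.
have /permP e := cg.
have := e 0; have := e 1; have := e 2%:R; have := e 3%:R.
rewrite !permM /s12_4 tpermL tpermR.
rewrite (@tpermD _ 0 1 2%:R) // (@tpermD _ 0 1 3%:R) //.
have inj x y : x != y -> g x != g y by apply: contra_neq; apply: perm_inj.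
have := inj 0 1 isT; have := inj 0 2%:R isT; have := inj 0 3%:R isT.
have := inj 1 2%:R isT; have := inj 1 3%:R isT; have := inj 2%:R 3%:R isT.
have all4 (x : 'I_4) : [\/ x = 0, x = 1, x = 2%:R | x = 3%:R].
  by case: x => [[|[|[|[|//]]]] ?];
    [constructor 1 | constructor 2 | constructor 3 | constructor 4]; apply: val_inj.
by case: (all4 (g 0)) => ->; case: (all4 (g 1)) => ->;
   case: (all4 (g 2%:R)) => ->; case: (all4 (g 3%:R)) => ->;
   rewrite ?tpermL ?tpermR ?(@tpermD _ 0 1 2%:R) ?(@tpermD _ 0 1 3%:R).
Qed.

Lemma oplus_4_M a b :
  {in 'C[s12_4]%G &, {morph oplus_4 a b : x y / (x * y)%g >-> x * y}}.
Proof.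
move=> x y /cent_s12_4[x01 x23] /cent_s12_4[y01 y23].
rewrite /oplus_4 !permM mulrACA -!signr_addb -!andb_addr.
have -> : (y (x 0) != 0) = (x 0 != 0) (+) (y 0 != 0).
  by case/orP: x01 => /andP[/eqP-> _]; case/orP: y01 => /andP[/eqP e /eqP e'];
    rewrite ?e ?e'.
suff -> : (y (x 2%:R) != 2%:R) = (x 2%:R != 2%:R) (+) (y 2%:R != 2%:R) by [].
by case/orP: x23 => /andP[/eqP-> _]; case/orP: y23 => /andP[/eqP e /eqP e'];
    rewrite ?e ?e'.
Qed.

Lemma oplus_4_s12 a b : oplus_4 a b s12_4 = (-1) ^+ a.
Proof. by rewrite /oplus_4 tpermL tpermD // eqxx andbT andbF mulr1. Qed.

Lemma oplus_4_s34 a b : oplus_4 a b s34_4 = (-1) ^+ b.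
Proof. by rewrite /oplus_4 tpermL tpermD // eqxx andbT andbF mul1r. Qed.

Definition rep_oplus_4 a b : mx_representation F 'C[s12_4]%G 1 :=
  lin_repr (oplus_4_1 a b) (@oplus_4_M a b).

Definition rep_sgn_eps_4 := rep_oplus_4 true false.
Definition rep_sgn_sgn_4 := rep_oplus_4 true true.

(* chi_4(tau4 ^ k) = w ^ k, where k is read off as the image of the first
   letter. *)
Section Chi4.
Variables (w : F) (w_prim : 4.-primitive_root w).

Definition chi4 (g : 'S_4) : F := w ^+ (g 0 : 'I_4).

Lemma chi4_1 : chi4 1%g = 1.
Proof. by rewrite /chi4 perm1. Qed.

Lemma tau4X k (i : 'I_4) : (tau4 ^+ k)%g i = ((i + k) %% 4)%N :> nat.
Proof.
elim: k => [|k IHk]; first by rewrite perm1 addn0 modn_small.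
by rewrite expgSr permM permE /= IHk -addn1 modnDml addn1 addnS.
Qed.

Lemma chi4_M : {in 'C[tau4]%G &, {morph chi4 : x y / (x * y)%g >-> x * y}}.
Proof.
move=> x y _ /cent1P cy; rewrite /chi4 permM -exprD.
have x0 : x 0 = (tau4 ^+ (x 0 : 'I_4))%g 0.
  by apply: val_inj; rewrite /= tau4X add0n modn_small.
have -> : y (x 0) = (tau4 ^+ (x 0 : 'I_4))%g (y 0).
  by rewrite {1}x0 -!permM (commuteX _ cy).
by rewrite tau4X (expr_mod _ (prim_expr_order w_prim)) addnC.
Qed.

Lemma chi4_tau4 : chi4 tau4 = w.
Proof. by rewrite /chi4 permE. Qed.

Lemma chi4_sqr_1 : chi4 1%g ^+ 2 = 1.
Proof. by rewrite chi4_1 expr1n. Qed.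

Lemma chi4_sqr_M :
  {in 'C[tau4]%G &, {morph (fun g => chi4 g ^+ 2) : x y / (x * y)%g >-> x * y}}.
Proof. by move=> x y xG yG /=; rewrite chi4_M // exprMn. Qed.

Definition rep_chi4_sqr : mx_representation F 'C[tau4]%G 1 :=
  lin_repr chi4_sqr_1 chi4_sqr_M.

End Chi4.
End Characters.

(* Main.v *)
From HB Require Import structures.
Require Import Defs.
From mathcomp Require Import all_boot all_order all_algebra all_fingroup.
From mathcomp Require Import mxrepresentation complex boolp functions reals.
From mathcomp Require Import zify ring.

Set Implicit Arguments.
Unset Strict Implicit.
Unset Printing Implicit Defensive.

Import GRing.Theory.
Local Open Scope ring_scope.

(** By Schur's lemma the element [s], being central in its centralizer, acts on
    the irreducible representation [rho] by a scalar [lam].  The theorem holds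
    because every module outside the three stated families contains finitely
    many homogeneous vectors [x_i] of distinct degrees with
    [c (x_i (x) x_j) = q_ij x_j (x) x_i], and the matrix [q] already forces
    infinite dimension:

    - if [lam = 1], one vector with [q_11 = 1] ([central_scalar_neq1]);
    - if [s] is conjugate to [s^-1 <> s] and [lam ^+ 2 <> 1], two vectors with
      [q_11 = q_22 = lam] and [q_12 = q_21 = lam^-1] ([central_scalar_real]);
    - if [s] has type (2,2) in S_4 and [lam = -1], three vectors, permuted by a
      3-cycle, with [q_ii = -1] and [q_ij q_ji = -1] ([central_scalar_klein]).

    One argument covers the three cases ([infinite_of_root_vector]).  The sum of
    the degrees of the letters behaves as an imaginary root: a vector [z] of that
    degree in the tensor algebra braids trivially with itself.  Take [z] to be an
    iterated braided commutator of the letters: it is killed by all but one of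
    the skew derivations.  Composing one skew derivation for each letter, ending
    with those that kill [z], gives an operator [D] with [D z = c] a nonzero
    scalar, and the twisted Leibniz rule yields [D (z ^ m) = m c z ^ (m - 1)].  Hence [D ^ m (z ^ m) = m! c ^ m],
    which is not zero in characteristic zero, and [z ^ m] survives in the
    Nichols algebra for all [m].

    To connect this to the quantum symmetrizer, the operator [c_w] of a diagonal
    braiding is computed on words: it multiplies by [q_ij] for every inversion
    ([braid_perm_word]).  Splitting a permutation of [m + 1] positions into the
    position sent to the end and a permutation of the others then shows that the
    coefficients of the symmetrized tensor are iterated skew derivations
    ([symmetrized_coef_der]).

    A 3-cycle would need [lam ^+ 2 = 1] and [lam ^+ 3 = 1], that is [lam = 1].  So
    what remains in S_3 and S_4 is [lam = -1] with [s] a transposition or a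
    4-cycle.  The centralizer is then abelian, so [rho] is a character that is
    determined by its values on one or two generators, and conjugate data give
    isomorphic modules ([yd_iso_conj]). *)

(** * Inversions and reduced expressions *)

Section Inversions.
Variable m : nat.
Implicit Types (w : 'S_m) (k : 'I_m.-1) (p : 'I_m * 'I_m).

Definition inversion w p := (p.1 < p.2)%N && (w p.2 < w p.1)%N.

Lemma simple_transpE k (x : 'I_m) :
  simple_transp k x =
    (if x == k :> nat then k.+1 else if x == k.+1 :> nat then k : nat else x) :> nat.
Proof.
rewrite /simple_transp; case: tpermP => [->|->|/eqP xl /eqP xr] /=.
- by rewrite eqxx.
- by rewrite /= eqxx; case: ifP => //; lia.
- by rewrite -[(x == k :> nat)]/(x == posl k) -[(x == k.+1 :> nat)]/(x == posr k)
    (negbTE xl) (negbTE xr).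
Qed.

Lemma ltn_simple_transp k (x y : 'I_m) :
  ~~ ((x == k :> nat) && (y == k.+1 :> nat)) -> ~~ ((y == k :> nat) && (x == k.+1 :> nat)) ->
  (simple_transp k x < simple_transp k y)%N = (x < y)%N.
Proof.
rewrite !simple_transpE; do 4?case: ifP => ?.
all: lia.
Qed.

(** The transposition of the values [k] and [k.+1] changes the relative order of
    no other pair of values, so exactly one inversion is created.  Over the
    monoid of natural numbers this counts inversions, over a field it follows
    the scalar produced by a diagonal braiding. *)
Lemma big_inversions_ascent (R : Type) (idx : R) (op : Monoid.com_law idx)
    (f : 'I_m * 'I_m -> R) w k :
  let l := (w^-1)%g (posl k) in let r := (w^-1)%g (posr k) in
  (l < r)%N ->
  \big[op/idx]_(p | inversion (w * simple_transp k)%g p) f p =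
    op (\big[op/idx]_(p | inversion w p) f p) (f (l, r)).
Proof.
move=> l r lr; have wl : w l = posl k by rewrite permKV.
have wr : w r = posr k by rewrite permKV.
rewrite (bigD1 (l, r)) /=; last first.
  by rewrite /inversion /= lr !permM wl wr !simple_transpE /= !eqxx; case: ifP; lia.
rewrite Monoid.mulmC; congr (op _ _); apply: eq_bigl => -[i j] /=.
rewrite /inversion /= !permM.
have [ij|//] := ltnP i j; rewrite /= -pair_eqE /=.
have eq_l x : (w x == k :> nat) = (x == l).
  by rewrite -(inj_eq (@perm_inj _ w)) wl.
have eq_r x : (w x == k.+1 :> nat) = (x == r).
  by rewrite -(inj_eq (@perm_inj _ w)) wr.
have [/andP[/eqP -> /eqP ->]|ijlr] := boolP ((i == l) && (j == r)).
  by rewrite andbF wl wr /=; lia.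
rewrite andbT ltn_simple_transp // !eq_l !eq_r.
  by apply: contraL ij => /andP[/eqP-> /eqP->]; rewrite -leqNgt ltnW.
by rewrite ijlr.
Qed.

Definition inversions w := #|inversion w|.

Lemma inversions_ascent w k :
  ((w^-1)%g (posl k) < (w^-1)%g (posr k))%N ->
  inversions (w * simple_transp k)%g = (inversions w).+1.
Proof.
by move=> lr; rewrite /inversions -!sum1_card big_inversions_ascent //= addn1.
Qed.

Lemma simple_transpK k : (simple_transp k * simple_transp k = 1)%g.
Proof. exact: tperm2. Qed.

Lemma inversions_descent w k :
  ((w^-1)%g (posr k) < (w^-1)%g (posl k))%N ->
  inversions w = (inversions (w * simple_transp k)%g).+1.
Proof.
move=> rl; rewrite -(@inversions_ascent _ k).
  by rewrite -mulgA simple_transpK mulg1.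
by rewrite invMg !permM /simple_transp tpermV tpermL tpermR.
Qed.

Lemma inversions_le_size ks : (inversions (\prod_(k <- ks) simple_transp k)%g <= size ks)%N.
Proof.
elim/last_ind: ks => [|ks k IH].
  rewrite big_nil leqn0 /inversions; apply/pred0P => -[i j].
  by rewrite /inversion /= !perm1; lia.
rewrite -cats1 big_cat big_seq1 /= cats1 size_rcons.
set w := (\prod_(k <- ks) _)%g in IH *.
case: (ltngtP ((w^-1)%g (posl k)) ((w^-1)%g (posr k))).
- by move=> h; rewrite inversions_ascent.
- by move=> h; rewrite (inversions_descent h) in IH; exact: leqW (ltnW IH).
- by move/val_inj/perm_inj/(congr1 val) => /= /n_Sn.
Qed.

Lemma no_descent w :
  (forall k, ((w^-1)%g (posl k) < (w^-1)%g (posr k))%N) -> w = 1%g.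
Proof.
move=> asc; apply: invg_inj; rewrite invg1.
have mono : forall d (i j : 'I_m), j = (i + d)%N :> nat -> ((w^-1)%g i + d <= (w^-1)%g j)%N.
  elim=> [|d IH] i j ijd.
    by rewrite addn0 (_ : j = i) //; apply: val_inj; rewrite /= ijd addn0.
  have jk : (i + d < m.-1)%N by have := ltn_ord j; lia.
  have := IH i (posl (Ordinal jk)) erefl; have := asc (Ordinal jk).
  have -> : posr (Ordinal jk) = j by apply: val_inj; rewrite /= ijd addnS.
  lia.
apply/permP => i; rewrite perm1; apply: val_inj => /=.
have m0 : (0 < m)%N by apply: leq_ltn_trans (ltn_ord i).
have m1 : (m.-1 < m)%N by rewrite ltn_predL.
have low := mono i (Ordinal m0) i erefl.
have high := mono (m.-1 - i)%N i (Ordinal m1) (esym (subnKC _)).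
have le_i : (i <= m.-1)%N by have := ltn_ord i; lia.
have {high} := leq_trans (high le_i) (ltnSE (leq_trans (ltn_ord _) (leqSpred m))).
move: low; rewrite /=; move: ((w^-1)%g i : nat) ((w^-1)%g (Ordinal m0) : nat) => x y; lia.
Qed.

Lemma posl_posr_neq w k : w (posl k) <> w (posr k) :> nat.
Proof. by move=> /val_inj/perm_inj/(congr1 val) /=; lia. Qed.

(** Sorting: every descent of [w^-1] is removed by one simple transposition, and
    only the identity has no descent. *)
Lemma inversions_expr w :
  exists2 ks, w = (\prod_(k <- ks) simple_transp k)%g & size ks = inversions w.
Proof.
move e : (inversions w) => n; elim: n w e => [|n IH] w e.
  exists [::] => //; rewrite big_nil; apply: no_descent => k.
  case: ltngtP (@posl_posr_neq (w^-1)%g k) => // h _.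
  by rewrite (inversions_descent h) in e.
case: (pickP (fun k => (w^-1)%g (posr k) < (w^-1)%g (posl k))%N) => [k h|asc].
  have [|ks ksE <-] := IH (w * simple_transp k)%g.
    by apply: succn_inj; rewrite -(inversions_descent h).
  exists (rcons ks k); last by rewrite size_rcons.
  by rewrite -cats1 big_cat big_seq1 /= -ksE -mulgA simple_transpK mulg1.
have w1 : w = 1%g.
  by apply: no_descent => k; have := asc k; case: ltngtP (@posl_posr_neq (w^-1)%g k) => // <-.
by have := inversions_le_size [::]; rewrite big_nil -w1 e.
Qed.

Lemma size_reduced_expr w : size (reduced_expr w) = inversions w.
Proof.
have [wE min] := reduced_exprP w; have [ks ksE sksE] := inversions_expr w.
apply/eqP; rewrite eqn_leq -{1}sksE min //=.
by rewrite [inversions w](congr1 inversions wE) inversions_le_size.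
Qed.

End Inversions.

(** * The quantum symmetrizer on a family of diagonal type *)
Section DiagonalFamily.
Variables (F : fieldType) (V : vectType F) (c : tpow V 2 -> tpow V 2).
Hypothesis c_linear : linear c.
Local Notation d := (\dim {:V}).
Local Notation e := (vbasis {:V}).

Lemma eq_tens m (u v : 'I_m -> V) : u =1 v -> tens u = tens v.
Proof. by move=> uv; apply/ffunP => a; rewrite !ffunE; apply: eq_bigr => i _; rewrite uv. Qed.

Lemma posl_neq_posr m (k : 'I_m.-1) : (posl k == posr k) = false.
Proof. by apply/eqP => /(congr1 val) /= /n_Sn. Qed.

Lemma legs_tens m (k : 'I_m.-1) a (v : 'I_m -> V) :
  legs k a (tens v) =
  (\prod_(j | (j != posl k) && (j != posr k)) coord e (a j) (v j)) *:
    (tens2 (v (posl k)) (v (posr k)) : tpow V 2).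
Proof.
have last2 : lift ord0 ord0 = ord_max :> 'I_2 by apply: val_inj.
apply/ffunP => b; rewrite !ffunE big_ord_recl big_ord1 last2 /=.
rewrite (bigD1 (posl k)) //= (bigD1 (posr k)) /=; last by rewrite eq_sym posl_neq_posr.
rewrite !ffunE eqxx eq_sym posl_neq_posr eqxx.
under eq_bigr => j /andP[/negbTE jl /negbTE jr] do rewrite ffunE jl jr.
by rewrite mulrA mulrC.
Qed.

Lemma braid_at_linear m (k : 'I_m.-1) : linear (braid_at c k).
Proof.
move=> s x y; apply/ffunP => a; rewrite !ffunE.
have -> : legs k a (s *: x + y) = s *: legs k a x + legs k a y.
  by apply/ffunP => b; rewrite !ffunE.
by rewrite c_linear !ffunE.
Qed.

HB.instance Definition _ m (k : 'I_m.-1) :=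
  GRing.isLinear.Build F (tpow V m) (tpow V m) _ (braid_at c k) (braid_at_linear k).

Lemma foldl_braid_linear m ks :
  linear (foldl (fun y k => braid_at c k y) ^~ ks : tpow V m -> tpow V m).
Proof. by elim: ks => [//|k ks IH] s x y /=; rewrite braid_at_linear IH. Qed.

Lemma braid_perm_linear m w : linear (@braid_perm F V c m w).
Proof. by move=> s u v; apply: foldl_braid_linear. Qed.

HB.instance Definition _ m w :=
  GRing.isLinear.Build F (tpow V m) (tpow V m) _ (@braid_perm F V c m w)
    (@braid_perm_linear m w).

Variables (I : finType) (x : I -> V) (q : I -> I -> F).
Hypothesis c_diag : forall i j, c (tens2 (x i) (x j)) = q i j *: (tens2 (x j) (x i) : tpow V 2).

Definition word_tens m (a : 'I_m -> I) : tpow V m := tens (fun p => x (a p)).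

Lemma braid_at_word m (k : 'I_m.-1) (a : 'I_m -> I) :
  braid_at c k (word_tens a) =
  q (a (posl k)) (a (posr k)) *: word_tens (fun p => a (simple_transp k p)).
Proof.
have c0 : c 0 = 0 by have := c_linear (-1) 0 0; rewrite !scaleN1r oppr0 addr0 addNr.
apply/ffunP => b; rewrite ffunE legs_tens -[_ *: tens2 _ _]addr0 c_linear c0 addr0 c_diag.
rewrite !ffunE [in RHS](bigD1 (posl k)) //= [in RHS](bigD1 (posr k)) /=; last first.
  by rewrite eq_sym posl_neq_posr.
rewrite big_ord_recl big_ord1 !ffunE /simple_transp tpermL tpermR /=.
under [in RHS]eq_bigr => j /andP[jl jr].
  rewrite tpermD; [over | by rewrite eq_sym | by rewrite eq_sym].
by rewrite /GRing.scale /=; ring.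
Qed.

(** Each letter of an expression whose length is the number of inversions must
    create an inversion, and it is this pair of letters that the braiding
    exchanges.  So the scalar depends on the permutation alone, whichever
    reduced expression is chosen. *)
Lemma foldl_braid_word m ks (a : 'I_m -> I) :
  let w := (\prod_(k <- ks) simple_transp k)%g in
  size ks = inversions w ->
  foldl (fun y k => braid_at c k y) (word_tens a) ks =
  (\prod_(p | inversion w p) q (a p.1) (a p.2)) *: word_tens (fun p => a ((w^-1)%g p)).
Proof.
elim/last_ind: ks => [|ks k IH] /=.
  rewrite big_nil => _; rewrite big1 ?scale1r; last first.
    by move=> p; rewrite /inversion !perm1 => /andP[/ltn_trans/[apply]]; rewrite ltnn.
  by apply: eq_tens => p; rewrite invg1 perm1.
rewrite -cats1 big_cat big_seq1 /= cats1 size_rcons foldl_rcons.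
set w := (\prod_(k <- ks) _)%g in IH *.
have [h|h|/posl_posr_neq h] := ltngtP ((w^-1)%g (posl k)) ((w^-1)%g (posr k)); last by [].
all: swap 1 2.
  (* A descent here would make the whole expression too short to be reduced. *)
  have := inversions_le_size ks; rewrite -/w (inversions_descent h) => /ltn_trans/(_ (ltnSn _)).
  by move=> /[swap] <-; rewrite ltnn.
rewrite (inversions_ascent h) => -[/IH ->].
rewrite linearZ /= braid_at_word scalerA big_inversions_ascent //=.
congr (_ *: _); apply: eq_tens => p.
by rewrite invMg permM /simple_transp tpermV.
Qed.

Lemma braid_perm_word m (w : 'S_m) (a : 'I_m -> I) :
  braid_perm c w (word_tens a) =
  (\prod_(p | inversion w p) q (a p.1) (a p.2)) *: word_tens (fun p => a ((w^-1)%g p)).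
Proof.
rewrite /braid_perm foldl_braid_word; have [<- _] := reduced_exprP w; rewrite //.
exact: size_reduced_expr.
Qed.

Variable phi : I -> 'Hom(V, F^o).
Hypothesis phi_dual : forall i j, phi i (x j) = (i == j)%:R.

(** The tensor product of the dual forms of the letters of [b]: it reads the
    coefficient of the word [b]. *)
Definition word_form m (b : 'I_m -> I) (t : tpow V m) : F :=
  \sum_(a : {ffun 'I_m -> 'I_d}) t a * \prod_(p < m) phi (b p) e`_(a p).

Lemma word_form_linear m (b : 'I_m -> I) : scalar (word_form b).
Proof.
move=> s t u; rewrite /word_form mulr_sumr -big_split; apply: eq_bigr => a _ /=.
by rewrite !ffunE mulrDl mulrA.
Qed.
HB.instance Definition _ m b :=
  GRing.isLinear.Build F (tpow V m) F _ (@word_form m b) (@word_form_linear m b).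

Lemma word_form_word m (a b : 'I_m -> I) :
  word_form b (word_tens a) = [forall p, b p == a p]%:R.
Proof.
transitivity (\prod_(p < m) phi (b p) (x (a p))); last first.
  under eq_bigr => p _ do rewrite phi_dual.
  have [/forallP ba|/forallPn[p ba]] := boolP [forall p, b p == a p].
    by rewrite big1 // => p _; rewrite ba.
  by rewrite (bigD1 p) //= (negbTE ba) mul0r.
transitivity (\prod_(p < m) \sum_(i < d) coord e i (x (a p)) * phi (b p) e`_i).
  rewrite bigA_distr_bigA; apply: eq_bigr => al _ /=.
  by rewrite ffunE -big_split.
apply: eq_bigr => p _; rewrite [in RHS](coord_vbasis (memvf (x (a p)))) linear_sum.
by apply: eq_bigr => i _; rewrite linearZ.
Qed.

(** The coefficient of the word [b] in the quantum symmetrizer applied to the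
    combination of words with coefficients [f]: the words carried to [b] by
    [w] are the [b o w]. *)
Definition symmetrized_coef m (f : {ffun 'I_m -> I} -> F) (b : 'I_m -> I) : F :=
  \sum_(w : 'S_m) (\prod_(p | inversion w p) q (b (w p.1)) (b (w p.2))) * f [ffun p => b (w p)].

Lemma quantum_symmetrizer_neq0 m (f : {ffun 'I_m -> I} -> F) (b : 'I_m -> I) :
  symmetrized_coef f b != 0 ->
  exists t : tpow V m, quantum_symmetrizer c t != 0.
Proof.
move=> nz; exists (\sum_(a : {ffun 'I_m -> I}) f a *: word_tens a).
apply: contra_neq nz => /(congr1 (word_form b)); rewrite linear0 => <-.
rewrite /quantum_symmetrizer linear_sum; apply: eq_bigr => w _.
rewrite !linear_sum (bigD1 [ffun p => b (w p)]) //= [X in _ + X]big1 ?addr0 => [|a ab].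
  rewrite !linearZ /= braid_perm_word linearZ /= word_form_word [RHS]mulrC.
  rewrite (_ : [forall p, _]); last by apply/forallP => p; rewrite ffunE permKV.
  by rewrite mulr1; congr (_ * _); apply: eq_bigr => p _; rewrite !ffunE.
rewrite !linearZ /= braid_perm_word linearZ /= word_form_word.
rewrite (_ : [forall p, _] = false) ?mulr0 //.
apply: contra_neqF ab => /forallP ab; apply/ffunP => p.
by rewrite ffunE (eqP (ab (w p))) permK.
Qed.

End DiagonalFamily.

(** * Skew derivations *)
Section InversionsLift.
Variables (R : Type) (idx : R) (op : Monoid.com_law idx).

Lemma big_inversion m (w : 'S_m) (g : 'I_m * 'I_m -> R) :
  \big[op/idx]_(p | inversion w p) g p =
  \big[op/idx]_i \big[op/idx]_j (if inversion w (i, j) then g (i, j) else idx).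
Proof.
by rewrite big_mkcond (pair_bigA _ (fun i j => if inversion w (i, j) then g (i, j) else idx));
  apply: eq_bigr => -[].
Qed.

Lemma ltn_lift m (k : 'I_m.+1) (i j : 'I_m) : (lift k i < lift k j)%N = (i < j)%N.
Proof. rewrite /= /bump; lia. Qed.

(** When [k] is sent to the last position it is overtaken by everything to its
    right; the other inversions are those of [w]. *)
Lemma big_inversion_lift m (k : 'I_m.+1) (w : 'S_m) (g : 'I_m.+1 * 'I_m.+1 -> R) :
  \big[op/idx]_(p | inversion (lift_perm k ord_max w) p) g p =
  op (\big[op/idx]_(l < m | (k <= l)%N) g (k, lift k l))
     (\big[op/idx]_(p | inversion w p) g (lift k p.1, lift k p.2)).
Proof.
rewrite !big_inversion (bigD1_ord k) //=; congr (op _ _).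
  rewrite (bigD1_ord k) //= {1}/inversion /= ltnn Monoid.mul1m [RHS]big_mkcond.
  apply: eq_bigr => l _; rewrite /inversion /= lift_perm_id lift_perm_lift lift_max /=.
  by rewrite ltn_ord andbT /bump; congr (if _ then _ else _); lia.
apply: eq_bigr => i _; rewrite (bigD1_ord k) //=.
have -> : inversion (lift_perm k ord_max w) (lift k i, k) = false.
  rewrite /inversion lift_perm_id lift_perm_lift; apply/negbTE/nandP; right.
  by rewrite -leqNgt leq_ord.
rewrite Monoid.mul1m.
by apply: eq_bigr => j _; rewrite /inversion /= !lift_perm_lift !ltn_lift.
Qed.

Lemma big_perm_lift m (g : 'S_m.+1 -> R) :
  \big[op/idx]_w g w = \big[op/idx]_(k < m.+1) \big[op/idx]_(w : 'S_m) g (lift_perm k ord_max w).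
Proof.
rewrite (pair_bigA _ (fun k w => g (lift_perm k ord_max w))) /=.
rewrite (reindex (fun p : 'I_m.+1 * 'S_m => lift_perm p.1 ord_max p.2)) //=.
apply: onW_bij; apply: inj_card_bij.
  move=> [k w] [k' w'] /= e.
  have kk' : k = k'.
    by apply: (@perm_inj _ (lift_perm k ord_max w)); rewrite lift_perm_id e lift_perm_id.
  rewrite -{}kk' in e *; congr (_, _); apply/permP => i.
  by apply: (@lift_inj _ ord_max); rewrite -!(lift_perm_lift k) e.
have cS n : #|{: 'S_n}| = n`! by rewrite -card_Sn; apply: eq_card => w; rewrite inE.
by rewrite card_prod !cS card_ord.
Qed.

End InversionsLift.

Section SkewDerivations.
Variables (F : fieldType) (I : finType) (q : I -> I -> F).
Local Notation series := (seq I -> F^o).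
Implicit Types (f : series) (j : I) (b : seq I).

(** A function [f] on words is read as the noncommutative series with
    coefficients [f b].  The skew derivation moves an occurrence of [j] to the
    end of the word, which costs a factor [q j c] for every letter [c] crossed,
    and removes it.  On coefficients this is a sum over the places where [j] can
    be inserted. *)
Definition skew_der j f : series := fun b =>
  \sum_(k < (size b).+1) (\prod_(c <- drop k b) q j c) * f (take k b ++ j :: drop k b).

Definition word m (a : 'I_m -> I) : seq I := mktuple a.

Lemma word_insert m (k : 'I_m.+1) (a : 'I_m.+1 -> I) :
  let a' := word (fun l => a (lift k l)) in word a = take k a' ++ a k :: drop k a'.
Proof.
move=> a'; have sa' : size a' = m by rewrite size_tuple.
have km := ltn_ord k.
apply: (@eq_from_nth _ (a k)).
  by rewrite size_cat size_take /= size_drop sa' size_tuple; case: ifP; lia.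
move=> n; rewrite size_tuple => n_lt.
rewrite -[n]/(Ordinal n_lt : nat) nth_mktuple.
have st : size (take k a') = k by rewrite size_takel // sa' -ltnS.
have [l ->|->] := unliftP k (Ordinal n_lt); last by rewrite nth_cat st ltnn subnn.
have a'l : nth (a k) a' l = a (lift k l) by rewrite nth_mktuple.
rewrite -a'l nth_cat st /= /bump; case: (leqP k l) => kl /=.
  by rewrite add1n ltnNge leqW // subSn //= nth_drop subnKC.
by rewrite add0n kl nth_take.
Qed.

Lemma prod_drop_word m k (a : 'I_m -> I) (g : I -> F) :
  \prod_(c <- drop k (word a)) g c = \prod_(l < m | (k <= l)%N) g (a l).
Proof.
case: m a => [|m] a.
  by rewrite (_ : word a = [::]) ?big_nil ?big_ord0 //; apply: size0nil; rewrite size_tuple.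
rewrite (big_nth (a ord0)) size_drop size_tuple.
under eq_bigr => n _ do rewrite nth_drop addnC.
rewrite -(big_addn 0 m.+1 k xpredT (fun n => g (nth (a ord0) (word a) n))) add0n big_geq_mkord.
by apply: eq_big => // l _; rewrite nth_mktuple.
Qed.

Lemma word_rcons m (b : 'I_m.+1 -> I) :
  word b = rcons (word (fun p => b (lift ord_max p))) (b ord_max).
Proof.
rewrite (word_insert ord_max) /= -cats1.
by rewrite take_oversize ?drop_oversize // size_tuple.
Qed.

Lemma eq_word m (a b : 'I_m -> I) : a =1 b -> word a = word b.
Proof. by move=> ab; congr tval; apply: eq_mktuple. Qed.

(** The factorization of the quantum symmetrizer of degree [m + 1] as that of
    degree [m] composed with the sum over the position that is sent to the end,
    read on coefficients. *)
Lemma symmetrized_coef_der m f (b : 'I_m -> I) :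
  symmetrized_coef q (fun a => f (word a)) b = foldr skew_der f (word b) [::].
Proof.
elim: m f b => [|m IH] f b.
  have nil0 (a : 'I_0 -> I) : word a = [::] by apply: size0nil; rewrite size_tuple.
  rewrite nil0 /= /symmetrized_coef (bigD1 1%g) //= [X in _ + X]big1 ?addr0 => [|w].
    by rewrite nil0 big1 ?mul1r // => -[[]].
  by case/eqP; apply/permP => -[].
rewrite word_rcons -cats1 foldr_cat /= -IH /symmetrized_coef big_perm_lift exchange_big /=.
apply: eq_bigr => w _; set b' := fun p => b (lift ord_max p).
rewrite /skew_der size_tuple mulr_sumr; apply: eq_bigr => k _.
rewrite big_inversion_lift /= lift_perm_id mulrCA mulrA prod_drop_word; congr (_ * _ * _).
- by apply: eq_bigr => l _; rewrite lift_perm_lift ffunE.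
- by apply: eq_bigr => p _; rewrite !lift_perm_lift.
rewrite (word_insert k) ffunE lift_perm_id.
by congr (f (take k _ ++ _ :: drop k _)); apply: eq_word => l;
   rewrite !ffunE lift_perm_lift.
Qed.

End SkewDerivations.

(** * Powers of a root vector *)
Section SeriesAlgebra.
Variables (F : fieldType) (I : finType) (q : I -> I -> F).
Local Notation series := (seq I -> F^o).
Implicit Types (f g z u : series) (i j k : I) (b w : seq I).
Local Notation der := (skew_der q).

Definition series_mul f g : series :=
  fun b => \sum_(n < (size b).+1) f (take n b) * g (drop n b).
Local Notation "f ** g" := (series_mul f g) (at level 40, left associativity).

Definition series_one : series := fun b => (b == [::])%:R.
Definition letter i : series := fun b => (b == [:: i])%:R.

(** The action on the tensor algebra of the group element that is the degree of
    the letter [k]. *)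
Definition twist k f : series := fun b => (\prod_(c <- b) q k c) * f b.

Lemma seriesDE f g b : (f + g) b = f b + g b. Proof. by []. Qed.
Lemma seriesZE a f b : (a *: f) b = a * f b. Proof. by []. Qed.
Lemma series0E b : (0 : series) b = 0. Proof. by []. Qed.
Definition seriesE := (seriesDE, seriesZE, series0E).

Lemma series_mul_cons f g c b :
  (f ** g) (c :: b) = f [::] * g (c :: b) + ((fun s => f (c :: s)) ** g) b.
Proof. by rewrite /series_mul big_ord_recl. Qed.

Lemma series_mul_nil f g : (f ** g) [::] = f [::] * g [::].
Proof. by rewrite /series_mul big_ord_recl big_ord0 addr0. Qed.

Lemma skew_der_cons j f c b :
  der j f (c :: b) = (\prod_(a <- c :: b) q j a) * f [:: j, c & b] + der j (fun s => f (c :: s)) b.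
Proof. by rewrite /skew_der big_ord_recl. Qed.

Lemma skew_der_nil j f : der j f [::] = f [:: j].
Proof. by rewrite /skew_der big_ord_recl big_ord0 addr0 big_nil mul1r. Qed.

Lemma series_mulZl a f u : (a *: f) ** u = a *: (f ** u).
Proof.
apply/funext => b; rewrite seriesE /series_mul mulr_sumr.
by apply: eq_bigr => n _; rewrite seriesE mulrA.
Qed.

Lemma series_mul_linear f : linear (series_mul f).
Proof.
move=> a g u; apply/funext => b; rewrite !seriesE /series_mul mulr_sumr -big_split.
by apply: eq_bigr => n _; rewrite !seriesE mulrDr mulrCA.
Qed.
HB.instance Definition _ f :=
  GRing.isLinear.Build F series series _ (series_mul f) (series_mul_linear f).

Lemma series_mulZr a f g : f ** (a *: g) = a *: (f ** g).
Proof. exact: linearZ. Qed.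

Lemma skew_der_linear j : linear (der j : series -> series).
Proof.
move=> a g u; apply/funext => b; rewrite !seriesE /skew_der mulr_sumr -big_split.
by apply: eq_bigr => n _; rewrite !seriesE mulrDr mulrCA.
Qed.
HB.instance Definition _ j :=
  GRing.isLinear.Build F series series _ (der j) (skew_der_linear j).

Lemma series_mul0l u : 0 ** u = 0.
Proof. by have := series_mulZl 0 0 u; rewrite !scale0r. Qed.

Lemma series_mul1l u : series_one ** u = u.
Proof.
apply/funext => -[|c b]; first by rewrite series_mul_nil mul1r.
rewrite series_mul_cons mul1r -[X in _ + X]/((0 ** u) b) series_mul0l.
by rewrite series0E addr0.
Qed.

Lemma series_mul1r u : u ** series_one = u.
Proof.
apply/funext => b; rewrite /series_mul big_ord_recr /= take_size drop_size mulr1.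
rewrite big1 ?add0r // => n _; rewrite /series_one -size_eq0 size_drop subn_eq0.
by rewrite leqNgt ltn_ord mulr0.
Qed.

(** Twisted Leibniz rule: a letter taken from the left factor crosses the whole
    right factor. *)
Lemma skew_der_mul j f g : der j (f ** g) = f ** der j g + der j f ** twist j g.
Proof.
apply/funext => b; rewrite seriesE; elim: b f => [|c b IH] f.
  rewrite skew_der_nil series_mul_cons !series_mul_nil !skew_der_nil /twist big_nil mul1r.
  by [].
have -> : der j (f ** g) (c :: b) =
    (\prod_(a <- c :: b) q j a) * (f ** g) [:: j, c & b]
    + (f [::] * der j (fun s => g (c :: s)) b + der j ((fun s => f (c :: s)) ** g) b).
  rewrite skew_der_cons; congr (_ + _); rewrite /skew_der mulr_sumr -big_split /=.
  by apply: eq_bigr => n _; rewrite series_mul_cons mulrDr mulrCA.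
rewrite IH !series_mul_cons [der j g (c :: b)]skew_der_cons skew_der_nil.
have -> : ((fun s => der j f (c :: s)) ** twist j g) b =
    (\prod_(a <- c :: b) q j a) * ((fun s => f [:: j, c & s]) ** g) b
    + (der j (fun s => f (c :: s)) ** twist j g) b.
  rewrite /series_mul mulr_sumr -big_split /=; apply: eq_bigr => n _.
  rewrite skew_der_cons mulrDl; congr (_ + _).
  rewrite /twist -[in c :: b](cat_take_drop n b) -cat_cons big_cat /=; ring.
rewrite /twist; ring.
Qed.

Lemma twist_linear k : linear (twist k).
Proof. by move=> a f g; apply/funext => b; rewrite /twist !seriesE mulrDr mulrCA. Qed.
HB.instance Definition _ k :=
  GRing.isLinear.Build F series series _ (twist k) (twist_linear k).

Lemma twist_mul k f g : twist k (f ** g) = twist k f ** twist k g.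
Proof.
apply/funext => b; rewrite /twist /series_mul mulr_sumr; apply: eq_bigr => n _.
by rewrite -{1}(cat_take_drop n b) big_cat /=; ring.
Qed.

Lemma twist_one k : twist k series_one = series_one.
Proof.
apply/funext => b; rewrite /twist /series_one; case: eqP => [->|_]; last by rewrite mulr0.
by rewrite big_nil mul1r.
Qed.

Lemma twist_letter k i : twist k (letter i) = q k i *: letter i.
Proof.
apply/funext => b; rewrite seriesE /twist /letter.
by case: eqP => [->|_]; rewrite ?big_seq1 // !mulr0.
Qed.

Lemma skew_der_one j : der j series_one = 0.
Proof.
apply/funext => b; apply: big1 => n _; rewrite /series_one -size_eq0 size_cat addnS mulr0 //.
Qed.

Lemma skew_der_letter j i : der j (letter i) = (i == j)%:R *: series_one.
Proof.
apply/funext => -[|c b]; last first.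
  rewrite seriesE /series_one /= mulr0; apply: big1 => n _.
  rewrite /letter (_ : (_ == _) = false) ?mulr0 //.
  apply: contraTF isT => /eqP/(congr1 size) /=; rewrite size_cat /= size_take size_drop /=.
  by case: ifP; have := ltn_ord n; rewrite /=; lia.
by rewrite skew_der_nil seriesE /letter /series_one eqseq_cons andbT eq_sym eqxx mulr1.
Qed.

Definition skew_ders w f : series := foldr der f w.

Lemma skew_ders_cons j w f : skew_ders (j :: w) f = der j (skew_ders w f).
Proof. by []. Qed.

Lemma skew_ders_cat w1 w2 f : skew_ders (w1 ++ w2) f = skew_ders w1 (skew_ders w2 f).
Proof. exact: foldr_cat. Qed.

Lemma skew_ders_linear w : linear (skew_ders w).
Proof. by elim: w => [|j w IH] // a f g; rewrite !skew_ders_cons IH linearP. Qed.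
HB.instance Definition _ w :=
  GRing.isLinear.Build F series series _ (skew_ders w) (skew_ders_linear w).

Lemma skew_ders_mul u g w (mu : I -> F) :
  (forall j, j \in w -> der j g = 0) -> (forall k, k \in w -> twist k g = mu k *: g) ->
  skew_ders w (u ** g) = (\prod_(k <- w) mu k) *: (skew_ders w u ** g).
Proof.
elim: w => [|j w IH] dg tg; first by rewrite big_nil scale1r.
have inW k : k \in w -> k \in j :: w by rewrite inE orbC => ->.
rewrite !skew_ders_cons IH => [|k /inW/dg//|k /inW/tg//].
rewrite linearZ /= skew_der_mul dg ?mem_head // linear0 add0r tg ?mem_head // linearZ /=.
by rewrite scalerA big_cons mulrC.
Qed.

Lemma skew_ders_mul_const z h w :
  (forall j, j \in w -> der j z = 0) -> skew_ders w (z ** h) = z ** skew_ders w h.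
Proof.
elim: w => [|j w IH] // dz; rewrite !skew_ders_cons IH => [|k kw]; last by rewrite dz // inE kw orbT.
by rewrite skew_der_mul dz ?mem_head // series_mul0l addr0.
Qed.

Definition series_exp z m : series := iter m (series_mul z) series_one.

Lemma skew_der_exp0 z j m : der j z = 0 -> der j (series_exp z m) = 0.
Proof.
move=> dz; elim: m => [|m IH] /=; first exact: skew_der_one.
by rewrite skew_der_mul IH dz linear0 series_mul0l addr0.
Qed.

Lemma twist_exp z k a m : twist k z = a *: z -> twist k (series_exp z m) = a ^+ m *: series_exp z m.
Proof.
move=> tz; elim: m => [|m IH] /=; first by rewrite twist_one scale1r.
by rewrite twist_mul tz IH series_mulZl linearZ /= scalerA exprS.
Qed.

(** The degree of [z] is an imaginary root: the product of the scalars by which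
    its letters act on [z] is [1].  Therefore the factors [z] crossed by the
    letters cost nothing in total, and the composed skew derivation [D] of the
    letters of [rcons w j] acts on the powers of [z] as [c] times the ordinary
    derivative.  As [D] applies [j] first, the derivations by the letters of
    [w], which kill [z], must all hit the factor that [j] has differentiated. *)
Section ImaginaryRootVector.
Variables (z : series) (w : seq I) (j : I) (lam : I -> F) (c : F).
Hypothesis der_z : forall i, i \in w -> der i z = 0.
Hypothesis twist_z : forall k, twist k z = lam k *: z.
Hypothesis lam1 : \prod_(k <- rcons w j) lam k = 1.
Hypothesis ders_z : skew_ders (rcons w j) z = c *: series_one.

Lemma skew_ders_exp m :
  skew_ders (rcons w j) (series_exp z m.+1) = (m.+1%:R * c) *: series_exp z m.
Proof.
have step n : skew_ders (rcons w j) (series_exp z n.+1) =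
    z ** skew_ders (rcons w j) (series_exp z n) + c *: series_exp z n.
  rewrite -[in LHS]cats1 -[in RHS]cats1 !skew_ders_cat.
  rewrite [skew_ders [:: j] _]skew_der_mul linearD /= skew_ders_mul_const //; congr (_ + _).
  rewrite (twist_exp n (twist_z j)) linearZ /= linearZ /=.
  rewrite (@skew_ders_mul _ _ _ (fun k => lam k ^+ n)) => [|i iw|i _]; first last.
  - by rewrite (twist_exp n (twist_z i)).
  - by rewrite skew_der_exp0 // der_z.
  rewrite scalerA; have -> : lam j ^+ n * (\prod_(k <- w) lam k ^+ n) = 1.
    by move: lam1; rewrite -cats1 big_cat big_seq1 prodrXl -exprMn mulrC /= => ->; rewrite expr1n.
  rewrite scale1r; move: ders_z; rewrite -cats1 skew_ders_cat => ->.
  by rewrite series_mulZl series_mul1l.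
elim: m => [|m IH]; rewrite step.
  rewrite -cats1 skew_ders_cat [skew_ders [:: j] _]skew_der_one linear0 linear0 add0r.
  by rewrite mul1r.
by rewrite IH linearZ /= -scalerDl -[m.+2]addn1 natrD mulrDl mul1r.
Qed.

Definition word_exp m := iter m (cat^~ (rcons w j)) [::].

Lemma skew_ders_word_exp m :
  skew_ders (word_exp m) (series_exp z m) = (m`!%:R * c ^+ m) *: series_one.
Proof.
elim: m => [|m IH]; first by rewrite /= mulr1 scale1r.
rewrite [word_exp _]/= skew_ders_cat skew_ders_exp linearZ /= IH scalerA.
by congr (_ *: _); rewrite factS natrM exprS; ring.
Qed.

Lemma size_word_exp m : size (word_exp m) = (m * (size w).+1)%N.
Proof. by elim: m => //= m IH; rewrite size_cat IH size_rcons mulSn addnC. Qed.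

End ImaginaryRootVector.

Section Adjoint.
Definition ad i f : series := letter i ** f - twist i f ** letter i.

Variables (f : series) (nu : I -> F).
Hypothesis twist_f : forall k, twist k f = nu k *: f.

Lemma twist_ad k i : twist k (ad i f) = (q k i * nu k) *: ad i f.
Proof.
rewrite /ad twist_f series_mulZl linearB linearZ /= !twist_mul twist_letter twist_f.
rewrite !(series_mulZl, series_mulZr) scalerBr !scalerA; congr (_ *: _ - _ *: _); ring.
Qed.

Lemma skew_der_ad i j : j != i ->
  der j (ad i f) = letter i ** der j f - (nu i * q j i) *: (der j f ** letter i).
Proof.
move=> ji; rewrite /ad twist_f linearB /= series_mulZl linearZ /= !skew_der_mul.
rewrite !skew_der_letter eq_sym (negbTE ji) scale0r series_mul0l addr0 linear0 add0r.
by rewrite twist_letter series_mulZr scalerA.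
Qed.

(** For [j = i] the two terms [f] of the braided commutator cancel: this is the
    reason for its coefficient. *)
Lemma skew_der_ad0 i j : der j f = 0 -> der j (ad i f) = 0.
Proof.
move=> df; have [<-|/skew_der_ad->] := eqVneq j i; last first.
  by rewrite df linear0 series_mul0l scaler0 subr0.
rewrite /ad twist_f linearB /= series_mulZl linearZ /= !skew_der_mul.
rewrite df linear0 !skew_der_letter eqxx !scale1r series_mul0l add0r addr0.
by rewrite series_mul1l series_mul1r twist_f subrr.

Qed.
End Adjoint.
End SeriesAlgebra.

(** * Infinite-dimensional Nichols algebras of diagonal type *)
Section FiniteDimension.
Variables (F : fieldType) (V : vectType F) (c : tpow V 2 -> tpow V 2).

(** The family concentrated in degree [m]; the degree indexes the type, so the
    component in degree [n] is transported along a proof of [m = n]. *)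
Definition homogeneous_tensor m (t : tpow V m) n : tpow V n :=
  match @eqP _ m n with ReflectT e => ecast k (tpow V k) e t | ReflectF _ => 0 end.

Lemma homogeneous_tensor_id m (t : tpow V m) : homogeneous_tensor t m = t.
Proof. by rewrite /homogeneous_tensor; case: eqP => // e; rewrite (eq_axiomK e). Qed.

Lemma homogeneous_tensor_finite m (t : tpow V m) :
  exists N, forall n, (N <= n)%N -> homogeneous_tensor t n = 0.
Proof.
exists m.+1 => n; rewrite /homogeneous_tensor; case: eqP => // mn lt_mn.
by rewrite -mn ltnn in lt_mn.
Qed.

(** Finitely many spanning elements are bounded in degree, so the Nichols algebra
    vanishes beyond that bound. *)
Lemma nichols_finite_dim_bound : nichols_finite_dim c ->
  exists N, forall m (t : tpow V m), (N <= m)%N -> quantum_symmetrizer c t = 0.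
Proof.
case=> r [b bP].
have /choice[N NP] : forall k, exists N, forall m, (N <= m)%N -> b k m = 0.
  by move=> k; case: (b k).
exists (\max_k N k)%N => m t le_m.
have [a aP] := bP (TensorAlgebra (homogeneous_tensor_finite t)).
have := aP m; rewrite /= homogeneous_tensor_id big1 ?subr0 // => k _.
by rewrite NP ?scaler0 // (leq_trans _ le_m) // (leq_bigmax k).
Qed.

End FiniteDimension.

Section DiagonalYD.
Variables (F : fieldType) (gT : finGroupType) (V : vectType F) (M : yd_module gT V).
Hypothesis char0 : [pchar F] =i pred0.

Lemma yd_braiding_linear : linear (yd_braiding M).
Proof.
move=> s t u; rewrite /yd_braiding scaler_sumr -big_split; apply: eq_bigr => b _ /=.
by rewrite !ffunE scalerDl scalerA.
Qed.

Variables (I : finType) (h : I -> gT) (x : I -> V) (q : I -> I -> F).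
Hypothesis h_inj : injective h.
Hypothesis x_deg : forall i, x i \in yd_comp M (h i).
Hypothesis x_neq0 : forall i, x i != 0.
Hypothesis x_diag : forall i j, yd_act M (h i) (x j) = q i j *: x j.

(** Distinct degrees make the family linearly independent: project to the degree
    of [x i], then take a coordinate where [x i] is not zero. *)
Lemma dual_forms : exists phi : I -> 'Hom(V, F^o), forall i j, phi i (x j) = (i == j)%:R.
Proof.
suff /choice[phi phiP] : forall i, exists phi : 'Hom(V, F^o), forall j, phi (x j) = (i == j)%:R.
  by exists phi.
move=> i.
have [k xk] : exists k, coord (vbasis {:V}) k (x i) != 0.
  apply: contrapT => /forallNP x0; have := x_neq0 i; rewrite (coord_vbasis (memvf (x i))).
  by rewrite big1 ?eqxx // => k _; have /negP/negPn/eqP-> := x0 k; rewrite scale0r.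
pose f : 'Hom(V, F^o) := linfun (coord (vbasis {:V}) k : V -> F^o).
exists ((coord (vbasis {:V}) k (x i))^-1 *: (f \o yd_proj M (h i))%VF) => j.
rewrite scale_lfunE comp_lfunE lfunE /= (yd_projE _ (x_deg j)) (inj_eq h_inj).
by case: eqP => [<-|_]; rewrite ?linear0 ?scaler0 // /GRing.scale /= mulVf.
Qed.

Local Notation der := (skew_der q).
Local Notation series := (seq I -> F^o).

Lemma word_tnth m (t : m.-tuple I) : word (tnth t) = t.
Proof. by congr tval; apply: eq_from_tnth => i; rewrite tnth_mktuple. Qed.

Lemma infinite_of_root_vector (z : series) (w : seq I) (j : I) (lam : I -> F) (c : F) :
  (forall i, i \in w -> der i z = 0) ->
  (forall k, twist q k z = lam k *: z) ->
  \prod_(k <- rcons w j) lam k = 1 ->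
  skew_ders q (rcons w j) z = c *: @series_one F I -> c != 0 ->
  ~ nichols_finite_dim (yd_braiding M).
Proof.
move=> der_z tw_z lam1 ders_z c0 /nichols_finite_dim_bound[N NP].
have [phi phiP] := dual_forms.
have diag i k : yd_braiding M (tens2 (x i) (x k)) = q i k *: (tens2 (x k) (x i) : tpow V 2).
  rewrite (yd_braidingE _ (x_deg i)) x_diag; apply/ffunP => b.
  by rewrite tens2E linearZ ffunE tens2E /GRing.scale /= mulrA.
pose b := in_tuple (word_exp w j N).
have := symmetrized_coef_der q (series_exp z N) (tnth b).
rewrite word_tnth -/(skew_ders q (word_exp w j N) (series_exp z N)).
rewrite (skew_ders_word_exp der_z tw_z lam1 ders_z) seriesZE mulr1 => coefE.
have [|t] := @quantum_symmetrizer_neq0 _ _ _ yd_braiding_linear _ _ _ diag _ phiP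
  _ (fun a => series_exp z N (word a)) (tnth b).
  rewrite coefE mulf_neq0 ?expf_neq0 //; have /charf0P-> := char0.
  by rewrite -lt0n fact_gt0.
by rewrite NP ?eqxx // size_word_exp leq_pmulr.
Qed.

Lemma infinite_rank1 i : q i i = 1 -> ~ nichols_finite_dim (yd_braiding M).
Proof.
move=> qii; apply: (@infinite_of_root_vector (@letter F I i) [::] i (q^~ i) 1) => //.
- by move=> k; rewrite twist_letter.
- by rewrite big_seq1.
- by rewrite skew_ders_cons skew_der_letter eqxx.
- exact: oner_neq0.
Qed.

(** The root vector is the commutator of [i] and [j].  Its skew derivative by [j]
    is [1 - q_ij q_ji] times the letter [i], which the second condition keeps
    from vanishing. *)
Lemma infinite_rank2 i j : i != j ->
  q i i * q j j * (q i j * q j i) = 1 -> q i j * q j i != 1 ->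
  ~ nichols_finite_dim (yd_braiding M).
Proof.
move=> ij q1 qij; have tw k := twist_letter q k j.
apply: (@infinite_of_root_vector (ad q i (@letter F I j)) [:: i] j
  (fun k => q k i * q k j) (1 - q i j * q j i)).
- move=> k /[!inE]/eqP->; rewrite (skew_der_ad0 tw) // skew_der_letter.
  by rewrite eq_sym (negbTE ij) scale0r.
- by move=> k; rewrite (twist_ad tw).
- by rewrite !big_cons big_nil mulr1 -q1; ring.
- rewrite !skew_ders_cons (skew_der_ad tw) 1?eq_sym // skew_der_letter eqxx scale1r.
  rewrite series_mul1r series_mul1l -[X in X - _]scale1r -scalerBl linearZ /=.
  by rewrite skew_der_letter eqxx scale1r.
- by rewrite subr_eq0 eq_sym.
Qed.

(** The root vector is the iterated commutator of [i], [j], [k].  The skew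
    derivation by [k] comes first, then [i], then [j]: in the other order the
    factor [1 - q_ik q_ki] would be replaced by
    [1 - q_ij q_ji q_ik q_ki], which vanishes when all [q_ij q_ji] are [-1]. *)
Lemma infinite_triangle i j k : i != j -> j != k -> i != k ->
  q i i * q j j * q k k * (q i j * q j i) * (q j k * q k j) * (q i k * q k i) = 1 ->
  q j k * q k j != 1 -> q i k * q k i != 1 ->
  ~ nichols_finite_dim (yd_braiding M).
Proof.
move=> ij jk ik q1 qjk qik.
have tw l := twist_letter q l k; have twj l := twist_ad tw l j.
have qij : q i j != 0.
  by apply: contra_eq_neq q1 => ->; rewrite !(mul0r, mulr0) eq_sym oner_neq0.
apply: (@infinite_of_root_vector (ad q i (ad q j (@letter F I k))) [:: j; i] k
  (fun l => q l i * (q l j * q l k)) ((1 - q j k * q k j) * (q i j * (1 - q i k * q k i)))).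
- move=> l ljk; rewrite (skew_der_ad0 twj) // (skew_der_ad0 tw) // skew_der_letter.
  by move: ljk; rewrite !inE => /orP[]/eqP->; rewrite eq_sym ?(negbTE jk) ?(negbTE ik) scale0r.
- by move=> l; rewrite (twist_ad twj).
- by rewrite !big_cons big_nil mulr1 -q1; ring.
- have ji : (j == i) = false by rewrite eq_sym (negbTE ij).
  have derk : der k (ad q j (@letter F I k)) = (1 - q j k * q k j) *: @letter F I j.
    rewrite (skew_der_ad tw) 1?eq_sym // skew_der_letter eqxx scale1r.
    by rewrite series_mul1r series_mul1l scalerBl scale1r.
  rewrite !skew_ders_cons (skew_der_ad twj) 1?eq_sym // derk.
  rewrite series_mulZl series_mulZr scalerA [X in _ - X *: _]mulrC -scalerA -scalerBr.
  rewrite linearZ linearZ -[RHS]scalerA; congr (_ *: _).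
  rewrite linearB linearZ /= !skew_der_mul !skew_der_letter eqxx ji.
  rewrite !scale1r !scale0r linear0 series_mul0l add0r addr0 series_mul1l series_mul1r.
  rewrite twist_letter -scalerBl linearZ /= skew_der_letter eqxx scale1r.
  by congr (_ *: _); ring.
- by rewrite !mulf_neq0 // subr_eq0 eq_sym.
Qed.

End DiagonalYD.

(** * Diagonal families inside the irreducible modules *)
Lemma yd_act_comp (F : fieldType) (gT : finGroupType) (V : vectType F) (M : yd_module gT V) g h x :
  x \in yd_comp M h -> yd_act M g x \in yd_comp M (h ^ g)%g.
Proof. by move=> xh; apply: (subvP (yd_compat M g h)); apply: memv_img. Qed.

Lemma yd_act_act (F : fieldType) (gT : finGroupType) (V : vectType F) (M : yd_module gT V) g h x :
  yd_act M h (yd_act M g x) = yd_act M (g * h)%g x.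
Proof. by rewrite yd_actM comp_lfunE. Qed.

Section InducedModule.
Variables (F : fieldType) (gT : finGroupType) (s : gT) (d : nat).
Variable rho : mx_representation F 'C[s]%G d.
Local Notation M := (yd_irr rho).
Implicit Types (g h : gT) (v : 'rV[F]_d).

Definition base_point : conj_class s := exist _ s (class_refl _ s).
Local Notation e := (conj_elt base_point).

Lemma conj_elt_base_cent : e \in 'C[s]%g.
Proof. by apply/cent1P; rewrite /commute [RHS]conjgC conj_eltP. Qed.

(** The vector usually written [1 (x) v].  The representative chosen for [s]
    itself is some element of the centralizer, whose action has to be undone. *)
Definition base_elt v : yd_space F s d := yd_elt base_point (v *m rho e^-1%g).

Lemma act_base_elt g v : g \in 'C[s]%g -> yd_act M g (base_elt v) = base_elt (v *m rho g).
Proof.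
move=> gC; rewrite /= yd_irr_act_elt.
have b : conj_act base_point g = base_point.
  by apply: val_inj => /=; move/cent1P: gC => sg; rewrite /conjg -sg mulKg.
have eC := conj_elt_base_cent.
rewrite /conj_cocycle b /base_elt -!mulmxA -!repr_mxM ?groupM ?groupV //.
by rewrite !mulgA mulVg mul1g.
Qed.

Lemma base_elt_comp v : base_elt v \in yd_comp M s.
Proof.
rewrite mem_yd_irr_comp; apply/forallP => t; apply/implyP => ts; rewrite ffunE.
by case: (t =P base_point) ts => // ->; rewrite eqxx.
Qed.

Lemma base_elt_linear : linear base_elt.
Proof. by move=> a u v; rewrite /base_elt mulmxDl -scalemxAl linearP. Qed.
HB.instance Definition _ :=
  GRing.isLinear.Build F 'rV[F]_d (yd_space F s d) _ base_elt base_elt_linear.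

Lemma base_elt_inj : injective base_elt.
Proof.
move=> u v /(congr1 (fun f : yd_space F s d => f base_point)); rewrite !ffunE eqxx.
have eC := conj_elt_base_cent.
move=> /(congr1 (mulmx^~ (rho e))); rewrite -!mulmxA -!repr_mxM ?groupV //.
by rewrite mulVg repr_mx1 !mulmx1.
Qed.

Section InfiniteDimension.
Hypothesis char0 : [pchar F] =i pred0.
Variables (I : finType) (g : I -> gT) (v : 'rV[F]_d) (q : I -> I -> F).
Hypothesis g_inj : injective (fun i => (s ^ g i)%g).
Hypothesis v_neq0 : v != 0.
Hypothesis g_cent : forall i j, (s ^ (g i * (g j)^-1))%g \in 'C[s]%g.
Hypothesis v_eigen : forall i j, v *m rho (s ^ (g i * (g j)^-1))%g = q i j *: v.

(** Translates of a single vector [1 (x) v]: the degree of one of them acts on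
    another one through the element [s ^ (g i * (g j)^-1)] of the centralizer. *)
Definition orbit_elt i : yd_space F s d := yd_act M (g i) (base_elt v).

Lemma orbit_elt_comp i : orbit_elt i \in yd_comp M (s ^ g i)%g.
Proof. exact/yd_act_comp/base_elt_comp. Qed.

Lemma orbit_elt_neq0 i : orbit_elt i != 0.
Proof.
apply: contra_neq v_neq0 => /(congr1 (yd_act M (g i)^-1%g)).
rewrite linear0 /orbit_elt yd_act_act mulgV yd_act1 id_lfunE => v0.
by apply: base_elt_inj; rewrite v0 linear0.
Qed.

Lemma orbit_elt_diag i j : yd_act M (s ^ g i)%g (orbit_elt j) = q i j *: orbit_elt j.
Proof.
rewrite /orbit_elt yd_act_act.
have -> : (g j * s ^ g i = s ^ (g i * (g j)^-1) * g j)%g.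
  by rewrite conjgM -conjgCV.
by rewrite yd_actM comp_lfunE act_base_elt // v_eigen !linearZ.
Qed.

End InfiniteDimension.
End InducedModule.

Section FiniteDimensionalNichols.
Variables (F : closedFieldType) (gT : finGroupType) (s : gT) (d : nat).
Variable rho : mx_representation F 'C[s]%G d.
Hypothesis char0 : [pchar F] =i pred0.
Hypothesis rho_irr : mx_irreducible rho.
Hypothesis rho_fin : nichols_irr_finite_dim rho.

Lemma irr_central_scalar : exists lam, rho s = lam%:M.
Proof.
apply/is_scalar_mxP/(mx_abs_irr_cent_scalar (group_closure_closed_field rho_irr)).
apply/centgmxP => g gC; rewrite -!repr_mxM ?cent1id //.
by move/cent1P: gC => ->.
Qed.

Lemma irr_vector : exists v : 'rV[F]_d, v != 0.
Proof.
have [d_gt0 _] := (mx_irrP _).1 rho_irr.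
by exists (delta_mx 0 (Ordinal d_gt0)); apply/eqP => /matrixP/(_ 0 (Ordinal d_gt0))/eqP;
   rewrite !mxE !eqxx oner_eq0.
Qed.

Lemma central_scalar_order lam n : rho s = lam%:M -> (s ^+ n = 1)%g -> lam ^+ n = 1.
Proof.
move=> rs sn.
have rsn : rho (s ^+ n)%g = (lam ^+ n)%:M.
  elim: n {sn} => [|n IH]; first by rewrite expg0 repr_mx1 expr0.
  by rewrite expgS repr_mxM ?groupX ?cent1id // IH rs -scalar_mxM -exprS.
have [v /negP v0] := irr_vector; move: rsn; rewrite sn repr_mx1 => /(congr1 (mulmx v)).
rewrite mulmx1 mul_mx_scalar -{1}[v]scale1r => /eqP.
by rewrite -subr_eq0 -scalerBl scaler_eq0 subr_eq0 => /orP[/eqP<-|].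
Qed.

Lemma central_scalar_neq1 lam : rho s = lam%:M -> lam != 1.
Proof.
move=> rs; apply: contraPneq rho_fin => lam1; have [v v0] := irr_vector.
apply: (@infinite_rank1 _ _ _ _ char0 unit (fun=> s ^ 1)%g (orbit_elt rho (fun=> 1)%g v)
  (fun _ _ => 1) _ _ _ _ tt erefl).
- by move=> [] [].
- by move=> i; apply: orbit_elt_comp.
- by move=> i; apply: orbit_elt_neq0.
- apply: orbit_elt_diag => _ _; rewrite mulgV conjg1 ?cent1id //.
  by rewrite rs mul_mx_scalar lam1.
Qed.

(** The vectors [1 (x) v] and its translate by [r], of degrees [s] and [s^-1],
    span a braided subspace of affine Cartan type A_1. *)
Lemma central_scalar_real lam r :
  rho s = lam%:M -> (s ^ r = s^-1)%g -> (s^-1)%g != s -> lam ^+ 2 = 1.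
Proof.
move=> rs sr s_inv; apply/eqP; apply: contraPT rho_fin => lam2.
have [v v0] := irr_vector.
have lam0 : lam != 0.
  apply: contra_eq_neq (central_scalar_order rs (expg_order s)) => ->.
  by rewrite expr0n; case: #[s]%g (order_gt0 s) => // n _; rewrite eq_sym oner_eq0.
have rsV : rho s^-1%g = (lam^-1)%:M.
  by rewrite repr_mxV ?cent1id // rs -invmx_scalar.
have srV : (s ^ r^-1 = s^-1)%g by rewrite -[in LHS](invgK s) conjVg -sr conjgK.
pose g (b : bool) := if b then r else 1%g.
pose q (b c : bool) := if b == c then lam else lam^-1.
have gE b c : (s ^ (g b * (g c)^-1) = if b == c then s else s^-1)%g.
  by case: b c => [] []; rewrite /g /= ?mulgV ?invg1 ?mulg1 ?mul1g ?conjg1.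
apply: (@infinite_rank2 _ _ _ _ char0 bool (fun b => s ^ g b)%g (orbit_elt rho g v)
  q _ _ _ _ true false erefl).
- move=> [] [] //=; rewrite conjg1 sr => /eqP; first by rewrite (negbTE s_inv).
  by rewrite eq_sym (negbTE s_inv).
- exact: orbit_elt_comp.
- by move=> i; apply: orbit_elt_neq0.
- apply: orbit_elt_diag => b c; rewrite gE; first by case: ifP; rewrite ?groupV cent1id.
  by rewrite /q; case: ifP => _; rewrite ?rs ?rsV mul_mx_scalar.
- by rewrite /q /=; field.
- by rewrite /q /= -expr2 exprVn invr_eq1.
Qed.

(** The elements [s], [s ^ r], [s ^ (r ^+ 2)] and [1] form a Klein group.  For a
    common eigenvector [v] on which [s ^ r] acts by [eps], the translates of
    [1 (x) v] by the powers of [r] span a triangle with [q_ii = -1] and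
    [q_ij q_ji = - eps ^+ 2 = -1], of affine Cartan type A_2. *)
Lemma central_scalar_klein r :
  (r ^+ 3 = 1)%g -> (s * s = 1)%g -> (s * s ^ r * s ^ (r ^+ 2) = 1)%g ->
  (s ^ r)%g \in 'C[s]%g -> (s ^ r)%g != s -> rho s != (-1)%:M.
Proof.
move=> r3 s2 sss srC sr_neq; apply: contraPneq rho_fin => rs.
have sC := cent1id s.
have [v v0 [eps [eps2 v_eps]]] : exists2 v : 'rV[F]_d, v != 0 &
    exists eps : F, eps * eps = 1 /\ v *m rho (s ^ r)%g = eps *: v.
  have [u u0] := irr_vector.
  (* As [s ^ r] is an involution, [u + u (s ^ r)] is fixed by it, unless it is zero. *)
  have [ur|ur] := eqVneq (u *m rho (s ^ r)%g) (- u).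
    by exists u => //; exists (-1); rewrite mulrNN mulr1 ur scaleN1r.
  exists (u + u *m rho (s ^ r)%g); first by rewrite addrC -[X in _ + X]opprK subr_eq0.
  exists 1; rewrite mulr1 scale1r mulmxDl -mulmxA -repr_mxM // -conjMg s2 conj1g.
  by rewrite repr_mx1 mulmx1 addrC.
have sr2 : (s ^ (r ^+ 2) = s ^ r * s)%g.
  apply: (mulgI (s * s ^ r)%g).
  by rewrite sss -mulgA (mulgA (s ^ r)%g) -conjMg s2 conj1g mul1g s2.
pose p n : F := if n == 0%N then -1 else if n == 1%N then eps else - eps.
pose q (i j : 'I_3) := p ((i + 2 * j) %% 3)%N.
(* As [r] has order dividing 3, [- j] may be written [2 * j]. *)
have gE (i j : 'I_3) : (s ^ (r ^+ i * (r ^+ j)^-1) = s ^ (r ^+ ((i + 2 * j) %% 3)))%g.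
  congr (s ^ _)%g; rewrite (expg_mod _ r3) expgD; congr (_ * _)%g.
  apply/(mulgI (r ^+ j)%g); rewrite mulgV -expgD -mulSn mulnC.
  by rewrite mulnC expgM r3 expg1n.
have pE n : (n < 3)%N -> (s ^ (r ^+ n))%g \in 'C[s]%g /\ v *m rho (s ^ (r ^+ n))%g = p n *: v.
  case: n => [|[|[|]]] // _; rewrite ?expg0 ?expg1 ?conjg1 /p /=.
  - by split=> //; rewrite rs mul_mx_scalar.
  - rewrite sr2; split; first by rewrite groupM.
    by rewrite repr_mxM // mulmxA v_eps rs mul_mx_scalar scalerA mulN1r.
have lt3 n : (n %% 3 < 3)%N by rewrite ltn_pmod.
have inj : injective (fun i : 'I_3 => (s ^ (r ^+ i))%g).
  move=> i j /(congr1 (conjg^~ (r ^+ j)^-1%g)); rewrite -!conjgM gE mulgV conjg1 => e.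
  have : ((i + 2 * j) %% 3 = 0)%N.
    have := lt3 (i + 2 * j)%N; move: e; case: (_ %% 3)%N => [|[|[|]]] // e _; exfalso.
      by move: sr_neq; rewrite expg1 in e; rewrite e eqxx.
    move: e sr_neq; rewrite sr2 => /(canRL (mulgK _)); rewrite mulgV => sr1.
    have s1 : s = 1%g by apply: (@conjg_inj _ r); rewrite sr1 conj1g.
    by rewrite sr1 s1 eqxx.
  by case: i e => [[|[|[|]]] // ?] _; case: j => [[|[|[|]]] // ?] _; apply: val_inj.
apply: (@infinite_triangle _ _ _ _ char0 'I_3 (fun i => s ^ (r ^+ i))%g
  (orbit_elt rho (fun i : 'I_3 => r ^+ i)%g v) q _ _ _ _ 0 1 2 erefl erefl erefl).
- exact: inj.
- exact: orbit_elt_comp.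
- by move=> i; apply: orbit_elt_neq0.
- by apply: orbit_elt_diag => i j; rewrite gE; have [] := pE _ (lt3 (i + 2 * j)%N).
- rewrite /q /p /=; transitivity ((eps * eps) ^+ 3); first by ring.
  by rewrite eps2 expr1n.
- by rewrite /q /p /= mulNr eps2 eq_sym -subr_eq0 opprK -(natrD _ 1 1); have /charf0P-> := char0.
- by rewrite /q /p /= mulrN eps2 eq_sym -subr_eq0 opprK -(natrD _ 1 1); have /charf0P-> := char0.
Qed.

End FiniteDimensionalNichols.

(** * Isomorphisms between irreducible modules *)
Section FrobeniusReciprocity.
Variables (F : fieldType) (gT : finGroupType) (s : gT) (d : nat).
Variable rho : mx_representation F 'C[s]%G d.
Variables (W : vectType F) (N : yd_module gT W) (iota : {linear 'rV[F]_d -> W}).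
Hypothesis iota_inj : injective iota.
Hypothesis iota_comp : forall v, iota v \in yd_comp N s.
Hypothesis iota_act : forall g v, g \in 'C[s]%g -> yd_act N g (iota v) = iota (v *m rho g).

Definition induced_fun (f : yd_space F s d) : W :=
  \sum_t yd_act N (conj_elt t) (iota (f t)).

Lemma induced_fun_linear : linear induced_fun.
Proof.
move=> a f g; rewrite /induced_fun scaler_sumr -big_split; apply: eq_bigr => t _ /=.
by rewrite !ffunE !linearP.
Qed.
HB.instance Definition _ :=
  GRing.isLinear.Build F (yd_space F s d) W _ induced_fun induced_fun_linear.

(** The irreducible module is induced from the centralizer of [s], so a map
    defined on [rho] extends to it.  It is injective as soon as [iota] is,
    because its restrictions to the homogeneous components land in distinct
    degrees. *)
Definition induced_hom : 'Hom(yd_space F s d, W) := linfun induced_fun.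

Lemma induced_hom_elt t v : induced_hom (yd_elt t v) = yd_act N (conj_elt t) (iota v).
Proof.
rewrite lfunE /= /induced_fun (bigD1 t) //= ffunE eqxx big1 ?addr0 // => u /negbTE ut.
by rewrite ffunE ut !linear0.
Qed.

Lemma induced_hom_act g : (induced_hom \o yd_act (yd_irr rho) g = yd_act N g \o induced_hom)%VF.
Proof.
apply/lfunP => f; rewrite [f]yd_space_sum !linear_sum; apply: eq_bigr => t _.
rewrite /= !comp_lfunE [yd_act (yd_irr rho) g _]yd_irr_act_elt !induced_hom_elt.
rewrite -iota_act ?conj_cocycle_cent // !yd_act_act.
by rewrite /conj_cocycle mulgKV.
Qed.

Lemma induced_elt_comp (t : conj_class s) v : yd_act N (conj_elt t) (iota v) \in yd_comp N (val t).
Proof. by rewrite -[val t]conj_eltP; apply: yd_act_comp. Qed.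

Lemma induced_hom_comp h : (induced_hom @: yd_comp (yd_irr rho) h <= yd_comp N h)%VS.
Proof.
apply/subvP => _ /memv_imgP[f fh ->]; rewrite lfunE; apply: memv_suml => t _.
move: fh; rewrite mem_yd_irr_comp => /forallP/(_ t); have [<- _|_ /eqP->] := eqVneq (val t) h.
  exact: induced_elt_comp.
by rewrite !linear0 mem0v.
Qed.

Lemma induced_hom_ker : lker induced_hom == 0%VS.
Proof.
apply/lker0P => f g /eqP; rewrite -subr_eq0 -linearB => /eqP fg0.
apply/eqP; rewrite -subr_eq0; apply/eqP; move: {f g}(f - g) fg0 => f f0.
apply/ffunP => t; rewrite ffunE; apply: iota_inj; rewrite linear0.
have /(congr1 (yd_act N (conj_elt t)^-1%g)) : yd_act N (conj_elt t) (iota (f t)) = 0.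
  move/(congr1 (yd_proj N (val t))): f0; rewrite linear0 /= lfunE linear_sum (bigD1 t) //=.
  rewrite (yd_projE _ (induced_elt_comp _ _)) eqxx big1 ?addr0 // => u ut.
  by rewrite (yd_projE _ (induced_elt_comp _ _)) eq_sym (inj_eq val_inj) (negbTE ut).
by rewrite linear0 yd_act_act mulgV yd_act1 id_lfunE.
Qed.

End FrobeniusReciprocity.

Section ConjugateData.
Variables (F : fieldType) (gT : finGroupType) (d : nat).

Lemma conj_induced_hom (s s' g : gT) (rho : mx_representation F 'C[s]%G d)
    (rho' : mx_representation F 'C[s']%G d) :
  (s ^ g = s')%g -> {in 'C[s]%g, forall h, rho' (h ^ g)%g = rho h} ->
  exists f : 'Hom(yd_space F s d, yd_space F s' d),
    [/\ lker f == 0%VS,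
        forall h, (f \o yd_act (yd_irr rho) h)%VF = (yd_act (yd_irr rho') h \o f)%VF
      & forall h, (f @: yd_comp (yd_irr rho) h <= yd_comp (yd_irr rho') h)%VS].
Proof.
move=> sg rhoE; pose N := yd_irr rho'.
pose iota : {linear 'rV[F]_d -> yd_space F s' d} := yd_act N g^-1%g \o base_elt rho'.
have iotaE v : iota v = yd_act N g^-1%g (base_elt rho' v) by [].
have iota_inj : injective iota.
  move=> u v; rewrite !iotaE => /(congr1 (yd_act N g)); rewrite !yd_act_act mulVg yd_act1 !id_lfunE.
  exact: base_elt_inj.
have iota_comp v : iota v \in yd_comp N s.
  by rewrite -[s](conjgK g) sg; apply/yd_act_comp/base_elt_comp.
have iota_act h v : h \in 'C[s]%g -> yd_act N h (iota v) = iota (v *m rho h).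
  move=> hC; rewrite !iotaE -rhoE // -act_base_elt; last by rewrite -sg cent1J memJ_conjg.
  by rewrite !yd_act_act conjgE mulgA mulgK.
exists (induced_hom s N iota); split.
- exact: induced_hom_ker.
- exact: induced_hom_act.
- exact: induced_hom_comp.
Qed.

(** Conjugate data embed into each other in both directions, so the dimensions
    agree and the embedding is onto. *)
Lemma yd_iso_conj (s s' g : gT) (rho : mx_representation F 'C[s]%G d)
    (rho' : mx_representation F 'C[s']%G d) :
  (s ^ g = s')%g -> {in 'C[s]%g, forall h, rho' (h ^ g)%g = rho h} ->
  yd_iso (yd_irr rho) (yd_irr rho').
Proof.
move=> sg rhoE; have [f [f_ker f_act f_comp]] := conj_induced_hom sg rhoE.
have [|h hC|f' [f'_ker _ _]] := @conj_induced_hom s' s g^-1 rho' rho.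
- by rewrite -sg conjgK.
- by rewrite -rhoE ?conjgKV // -(conjgK g s) sg cent1J memJ_conjg.
have dim_img (U V : vectType F) (k : 'Hom(U, V)) : lker k == 0%VS -> \dim (limg k) = \dim {:U}.
  by move=> /eqP k0; apply: limg_dim_eq; rewrite k0 capv0.
have f_img : limg f = fullv.
  apply/eqP; rewrite eqEdim subvf dim_img // -(dim_img _ _ _ f'_ker).
  by apply: dimvS; apply: subvf.
exists f; split=> //; exists f^-1%VF; first exact: lker0_lfunK.
by move=> v; apply: limg_lfunVK; rewrite f_img memvf.
Qed.

End ConjugateData.

(** * Permutations of three and four letters *)
Section PermutationCodes.
Variable n : nat.
Implicit Types (s t : 'S_n.+1) (a b : seq nat).

(** One-line notation.  Lists of numbers evaluate, so that a statement about all
    permutations of a few letters is decided by computation. *)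
Definition code s : seq nat := [seq val (s i) | i <- enum 'I_n.+1].
Definition codes : seq (seq nat) := permutations (iota 0 n.+1).
Definition code_mul a b : seq nat := [seq nth 0%N b i | i <- a].

Lemma size_code s : size (code s) = n.+1.
Proof. by rewrite size_map size_enum_ord. Qed.

Lemma nth_code s (i : 'I_n.+1) : nth 0%N (code s) i = s i.
Proof. by rewrite (nth_map ord0) ?size_enum_ord // nth_ord_enum. Qed.

Lemma code_inj : injective code.
Proof. by move=> s t st; apply/permP => i; apply: val_inj; rewrite /= -!nth_code st. Qed.

Lemma codeM s t : code (s * t)%g = code_mul (code s) (code t).
Proof. by rewrite /code_mul -map_comp; apply: eq_map => i /=; rewrite nth_code permM. Qed.

Lemma code1 : code 1%g = iota 0 n.+1.
Proof. by rewrite -val_enum_ord; apply: eq_map => i; rewrite perm1. Qed.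

Lemma code_in s : code s \in codes.
Proof.
rewrite mem_permutations; apply: uniq_perm; rewrite ?iota_uniq //.
  by rewrite map_inj_uniq ?enum_uniq // => i j /val_inj/perm_inj.
move=> k; rewrite mem_iota add0n /=; apply/mapP/idP => [[i _ ->]|k_lt].
  exact: ltn_ord.
by exists (s^-1 (Ordinal k_lt))%g; rewrite ?mem_enum // permKV.
Qed.

Lemma codeP a : a \in codes -> exists s, code s = a.
Proof.
rewrite mem_permutations => a_perm.
have sa : size a = n.+1 by rewrite (perm_size a_perm) size_iota.
have ltn (i : 'I_n.+1) : (nth 0%N a i < n.+1)%N.
  have : nth 0%N a i \in a by rewrite mem_nth ?sa.
  by rewrite (perm_mem a_perm) mem_iota.
have inj : injective (fun i : 'I_n.+1 => Ordinal (ltn i)).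
  move=> i j /(congr1 val) /= /eqP; rewrite nth_uniq ?sa // => [/eqP/val_inj//|].
  by rewrite (perm_uniq a_perm) iota_uniq.
exists (perm inj); apply: (@eq_from_nth _ 0%N); rewrite size_code ?sa // => k k_lt.
by rewrite -[k]/(val (Ordinal k_lt)) nth_code permE.
Qed.

Lemma all_codes (P : pred (seq nat)) : all P codes -> forall s, P (code s).
Proof. by move/allP => allP s; apply/allP/code_in. Qed.

Lemma has_codes (P : pred (seq nat)) : has P codes -> exists s, P (code s).
Proof. by case/hasP => a /codeP[s <-]; exists s. Qed.

Definition conj_code a b := has (fun g => has (fun h =>
  (code_mul g h == iota 0 n.+1) && (code_mul (code_mul h a) g == b)) codes) codes.

Lemma conj_codeP s t : conj_code (code s) (code t) -> exists g, (s ^ g)%g = t.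
Proof.
move=> /has_codes[g /has_codes[h]]; rewrite -code1 -!codeM !(inj_eq code_inj).
move=> /andP[/eqP gh /eqP <-]; exists g.
by rewrite /conjg (_ : g^-1 = h)%g ?mulgA //; apply: (mulgI g); rewrite mulgV.
Qed.

(** A conditional rather than a conjunction, so that conjugacy is tested for the
    inverse of [a] only. *)
Definition inverted_code a := has (fun b =>
  if code_mul a b == iota 0 n.+1 then (b != a) && conj_code a b else false) codes.

Lemma inverted_codeP s : inverted_code (code s) -> (s^-1 != s)%g /\ exists r, (s ^ r = s^-1)%g.
Proof.
move=> /has_codes[t]; rewrite -code1 -!codeM !(inj_eq code_inj).
case: eqP => // st /andP[ts /conj_codeP sr].
by have -> : (s^-1 = t)%g by apply: (mulgI s); rewrite mulgV.
Qed.

(** The inverse of [r], of order dividing 3, is computed as [r * r]. *)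
Definition klein_code a := has (fun r =>
  let b := code_mul (code_mul (code_mul r r) a) r in
  let c := code_mul (code_mul (code_mul r r) b) r in
  [&& code_mul r (code_mul r r) == iota 0 n.+1, code_mul a a == iota 0 n.+1,
      code_mul (code_mul a b) c == iota 0 n.+1, code_mul a b == code_mul b a & b != a]) codes.

Lemma klein_codeP s : klein_code (code s) -> exists r,
  [/\ (r ^+ 3 = 1)%g, (s * s = 1)%g, (s * s ^ r * s ^ (r ^+ 2) = 1)%g,
      (s ^ r)%g \in 'C[s]%g & (s ^ r)%g != s].
Proof.
move=> /has_codes[r]; lazy beta zeta; rewrite -code1 -!codeM !(inj_eq code_inj).
move=> /and5P[/eqP r3 /eqP s2]; have rV : (r * r = r^-1)%g by apply: (mulgI r); rewrite r3 mulgV.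
have rE t : (r * r * t * r = t ^ r)%g by rewrite rV conjgE mulgA.
rewrite !rE => /eqP sss /eqP sC sr; exists r; split=> //.
- by rewrite expgS expg1 conjgM.
- by apply/cent1P.
Qed.

End PermutationCodes.



Lemma code_s12_3 : code s12_3 = [:: 1; 0; 2]%N.
Proof. by rewrite /code !enum_ordSl (size0nil (size_enum_ord 0)) /= !permE. Qed.

Lemma code_s12_4 : code s12_4 = [:: 1; 0; 2; 3]%N.
Proof. by rewrite /code !enum_ordSl (size0nil (size_enum_ord 0)) /= !permE. Qed.

Lemma code_s34_4 : code s34_4 = [:: 0; 1; 3; 2]%N.
Proof. by rewrite /code !enum_ordSl (size0nil (size_enum_ord 0)) /= !permE. Qed.

Lemma code_tau4 : code tau4 = [:: 1; 2; 3; 0]%N.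
Proof. by rewrite /code !enum_ordSl (size0nil (size_enum_ord 0)) /= !permE. Qed.

Lemma perm3_cases (s : 'S_3) :
  [\/ s = 1%g,
      (s ^+ 3 = 1)%g /\ ((s^-1 != s)%g /\ exists r, (s ^ r = s^-1)%g)
    | exists g, (s ^ g = s12_3)%g].
Proof.
have /all_codes/(_ s) : all (fun a =>
   [|| a == iota 0 3, (code_mul a (code_mul a a) == iota 0 3) && inverted_code 2 a
     | conj_code 2 a [:: 1; 0; 2]%N]) (codes 2).
  by vm_compute.
rewrite -code_s12_3 -!code1 -!codeM !(inj_eq (@code_inj _)).
case/or3P => [/eqP->|/andP[/eqP s3 /inverted_codeP]|/conj_codeP].
- by constructor 1.
- by constructor 2; rewrite !expgS expg0 mulg1.
- by constructor 3.
Qed.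

Lemma perm4_cases (s : 'S_4) :
  [\/ s = 1%g,
      (s ^+ 3 = 1)%g /\ ((s^-1 != s)%g /\ exists r, (s ^ r = s^-1)%g),
      exists r, [/\ (r ^+ 3 = 1)%g, (s * s = 1)%g, (s * s ^ r * s ^ (r ^+ 2) = 1)%g,
      (s ^ r)%g \in 'C[s]%g & (s ^ r)%g != s]
   | ((s^-1 != s)%g /\ exists r, (s ^ r = s^-1)%g) /\ (exists g, (s ^ g = tau4)%g) \/
   exists g, (s ^ g = s12_4)%g].
Proof.
have /all_codes/(_ s) : all (fun a =>
   [|| a == iota 0 4, (code_mul a (code_mul a a) == iota 0 4) && inverted_code 3 a,
       klein_code 3 a, inverted_code 3 a && conj_code 3 a [:: 1; 2; 3; 0]%N
     | conj_code 3 a [:: 1; 0; 2; 3]%N]) (codes 3).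
  by vm_compute.
rewrite -code_s12_4 -code_tau4 -!code1 -!codeM !(inj_eq (@code_inj _)).
case/or4P => [/eqP->|/andP[/eqP s3 /inverted_codeP]|/klein_codeP|
  /orP[/andP[/inverted_codeP sV /conj_codeP]|/conj_codeP]].
- by constructor 1.
- by constructor 2; rewrite !expgS expg0 mulg1.
- by constructor 3.
- by constructor 4; left.
- by constructor 4; right.
Qed.

Lemma cent_s12_3 h : h \in 'C[s12_3]%g -> exists a b, h = (s12_3 ^+ a * 1 ^+ b)%g.
Proof.
move=> /cent1P/(congr1 (@code 2)); rewrite !codeM => hC.
have /all_codes/(_ h) : all (fun a => (code_mul a [:: 1; 0; 2] == code_mul [:: 1; 0; 2] a) ==>
    (a == iota 0 3) || (a == [:: 1; 0; 2]))%N (codes 2) by vm_compute.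
rewrite -code_s12_3 hC eqxx -code1 !(inj_eq (@code_inj _)) /=.
by case/orP => /eqP->; [exists 0%N, 0%N | exists 1%N, 0%N]; rewrite ?expg0 ?expg1 mulg1.
Qed.

Lemma cent_s12_4_gen h : h \in 'C[s12_4]%g -> exists a b, h = (s12_4 ^+ a * s34_4 ^+ b)%g.
Proof.
move=> /cent1P/(congr1 (@code 3)); rewrite !codeM => hC.
have /all_codes/(_ h) : all (fun a => (code_mul a [:: 1; 0; 2; 3] == code_mul [:: 1; 0; 2; 3] a) ==>
    [|| a == iota 0 4, a == [:: 1; 0; 2; 3], a == [:: 0; 1; 3; 2]
      | a == code_mul [:: 1; 0; 2; 3] [:: 0; 1; 3; 2]])%N (codes 3) by vm_compute.
rewrite -code_s12_4 -code_s34_4 hC eqxx -code1 -codeM !(inj_eq (@code_inj _)) /=.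
by case/or4P => /eqP->; [exists 0%N, 0%N | exists 1%N, 0%N | exists 0%N, 1%N | exists 1%N, 1%N];
   rewrite ?expg0 ?expg1 ?mulg1 ?mul1g.
Qed.

Lemma s34_4_cent : s34_4 \in 'C[s12_4]%g.
Proof.
by apply/cent1P; apply: (@code_inj 3); rewrite !codeM code_s12_4 code_s34_4.
Qed.

(** * The classification *)
Section GeneratedCentralizer.
Variables (F : fieldType) (gT : finGroupType) (s s' t' g : gT).
Hypothesis sg : (s ^ g = s')%g.
Hypothesis t'C : t' \in 'C[s']%g.
Hypothesis gen : forall h, h \in 'C[s']%g -> exists a b, h = (s' ^+ a * t' ^+ b)%g.

Lemma repr_mxX_cent (r : gT) (d : nat) (rho : mx_representation F 'C[r]%G d) h n :
  h \in 'C[r]%g -> rho (h ^+ n)%g = iter n (mulmx (rho h)) 1%:M.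
Proof.
move=> hC; elim: n => [|n IH]; first by rewrite expg0 repr_mx1.
by rewrite expgS repr_mxM ?groupX // IH.
Qed.

Lemma cent_conj h : ((h ^ g)%g \in 'C[s']%g) = (h \in 'C[s]%g).
Proof. by rewrite -sg cent1J memJ_conjg. Qed.

Lemma yd_iso_generators d (rho : mx_representation F 'C[s]%G d)
    (rho' : mx_representation F 'C[s']%G d) :
  rho' s' = rho s -> rho' t' = rho (t' ^ g^-1)%g -> yd_iso (yd_irr rho) (yd_irr rho').
Proof.
move=> rs rt; apply: (yd_iso_conj sg) => h hC.
have [a [b hE]] : exists a b, (h ^ g = s' ^+ a * t' ^+ b)%g by apply: gen; rewrite cent_conj.
have tC : (t' ^ g^-1)%g \in 'C[s]%g by rewrite -cent_conj conjgKV.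
have s'C := cent1id s'; have sC := cent1id s.
have -> : h = (s ^+ a * (t' ^ g^-1) ^+ b)%g.
  by apply: (@conjg_inj _ g); rewrite hE conjMg !conjXg conjgKV sg.
by rewrite conjMg !conjXg conjgKV sg !repr_mxM ?groupX // !repr_mxX_cent // rs rt.
Qed.

Lemma cent_abelian : abelian 'C[s]%g.
Proof.
rewrite -(abelianJ _ g) -cent1J sg; apply/centsP => h1 /gen[a1 [b1 ->]] h2 /gen[a2 [b2 ->]].
have st : commute s' t' by apply/commute_sym/cent1P.
have [st1 ts1] := (commuteX2 a1 b2 st, commuteX2 b1 a2 (commute_sym st)).
apply: commuteM; apply/commute_sym/commuteM.
- exact: commuteX2.
- exact: commuteX2.
- exact: commuteX2 (commute_sym _).
- exact: commuteX2.
Qed.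

End GeneratedCentralizer.

(** A permutation commuting with a full cycle is determined by the image of one
    letter. *)
Lemma cent_tau4 h : h \in 'C[tau4]%g -> exists a b, h = (tau4 ^+ a * 1 ^+ b)%g.
Proof.
move=> /cent1P hC; exists (h 0 : nat), 0%N; rewrite expg0 mulg1; apply/permP => j.
have tauj : j = (tau4 ^+ j)%g 0 by apply: val_inj; rewrite /= tau4X add0n modn_small.
rewrite {1}tauj -permM -(commuteX j hC) permM.
by apply: val_inj; rewrite /= !tau4X addnC.
Qed.

Section Classification.
Variables (F : closedFieldType) (char0 : [pchar F] =i pred0).

Section Reduction.
Variables (gT : finGroupType) (s : gT) (d : nat) (rho : mx_representation F 'C[s]%G d).
Hypothesis rho_irr : mx_irreducible rho.
Hypothesis rho_fin : nichols_irr_finite_dim rho.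

Lemma support_neq1 : s <> 1%g.
Proof.
move=> s1; have rs : rho s = 1%:M by rewrite [X in rho X]s1 repr_mx1.
by have := central_scalar_neq1 char0 rho_irr rho_fin rs; rewrite eqxx.
Qed.

Lemma central_scalar_N1 : (s ^+ 2 = 1)%g \/ ((s^-1 != s)%g /\ exists r, (s ^ r = s^-1)%g) ->
  rho s = (-1)%:M.
Proof.
have [lam rs] := irr_central_scalar rho_irr.
have lam1 := central_scalar_neq1 char0 rho_irr rho_fin rs.
move=> s_inv; suff : lam ^+ 2 == 1 by rewrite sqrf_eq1 (negbTE lam1) => /eqP lamN; rewrite rs lamN.
case: s_inv => [s2|[sV [r sr]]]; first by rewrite (central_scalar_order rho_irr rs s2).
by rewrite (central_scalar_real char0 rho_irr rho_fin rs sr sV).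
Qed.

(** Here [lam = -1] by [central_scalar_N1], against [lam ^+ 3 = 1]. *)
Lemma support_real_order3 : (s ^+ 3 = 1)%g ->
  ~ ((s^-1 != s)%g /\ exists r, (s ^ r = s^-1)%g).
Proof.
move=> s3 s_inv; have rs := central_scalar_N1 (or_intror s_inv).
have /eqP := central_scalar_order rho_irr rs s3.
by rewrite -signr_odd expr1 eq_sym -subr_eq0 opprK -(natrD _ 1 1); have /charf0P-> := char0.
Qed.

Lemma irr_dim1 : abelian 'C[s]%g -> d = 1%N.
Proof.
move=> /abelian_abs_irr ab; apply/eqP; rewrite -(ab _ _ rho).
exact: group_closure_closed_field.
Qed.

End Reduction.

Lemma S3_classification (s : 'S_3) (d : nat) (rho : mx_representation F 'C[s]%G d) :
  mx_irreducible rho -> nichols_irr_finite_dim rho ->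
  yd_iso (yd_irr rho) (yd_irr (rep_sgn_3 _)).
Proof.
move=> irr fin; case: (perm3_cases s) => [/(support_neq1 irr fin)|[s3]|[g sg]] //.
  by move/(support_real_order3 irr fin s3).
have d1 := irr_dim1 irr (cent_abelian sg (group1 _) cent_s12_3).
subst d; have s2 : (s ^+ 2 = 1)%g.
  by apply: (@conjg_inj _ g); rewrite conjXg sg conj1g expgS expg1 tperm2.
have rs := central_scalar_N1 irr fin (or_introl s2).
apply: (yd_iso_generators sg (group1 _) cent_s12_3).
- by rewrite rs /= sgn_3_s12.
- by rewrite conj1g !repr_mx1.
Qed.

Lemma S4_classification (w : F) (w_prim : 4.-primitive_root w)
  (s : 'S_4) (d : nat) (rho : mx_representation F 'C[s]%G d) :
  mx_irreducible rho -> nichols_irr_finite_dim rho ->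
     [\/ yd_iso (yd_irr rho) (yd_irr (rep_chi4_sqr w_prim)),
         yd_iso (yd_irr rho) (yd_irr (rep_sgn_eps_4 _))
       | yd_iso (yd_irr rho) (yd_irr (rep_sgn_sgn_4 _))].
Proof.
move=> irr fin; case: (perm4_cases s) =>
  [/(support_neq1 irr fin)|[s3]|[r [r3 s2 sss srC sr]]|[[s_inv [g sg]]|[g sg]]] //.
- by move/(support_real_order3 irr fin s3).
- have := central_scalar_klein char0 irr fin r3 s2 sss srC sr.
  by rewrite (central_scalar_N1 irr fin) ?eqxx //; left; rewrite expgS expg1.
- have d1 := irr_dim1 irr (cent_abelian sg (group1 _) cent_tau4); subst d.
  have rs := central_scalar_N1 irr fin (or_intror s_inv).
  constructor 1; apply: (yd_iso_generators sg (group1 _) cent_tau4).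
    rewrite rs /= chi4_tau4; congr (_%:M).
    have : w ^+ 2 == 1 = false by rewrite -(prim_order_dvd w_prim).
    have /eqP : (w ^+ 2) ^+ 2 = 1 by rewrite -exprM (prim_expr_order w_prim).
    by rewrite sqrf_eq1 => /orP[->|/eqP].
  by rewrite conj1g !repr_mx1.
have s34C := s34_4_cent.
have d1 := irr_dim1 irr (cent_abelian sg s34C cent_s12_4_gen); subst d.
have s2 : (s ^+ 2 = 1)%g.
  by apply: (@conjg_inj _ g); rewrite conjXg sg conj1g expgS expg1 tperm2.
have rs := central_scalar_N1 irr fin (or_introl s2).
pose u := (s34_4 ^ g^-1)%g.
have uC : u \in 'C[s]%g by rewrite -(cent_conj sg) conjgKV.
have : rho u = 1%:M \/ rho u = (-1)%:M.
  have : rho u *m rho u = 1%:M.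
    by rewrite -repr_mxM // -conjMg tperm2 conj1g repr_mx1.
  rewrite [rho u]mx11_scalar -scalar_mxM => /matrixP/(_ 0 0); rewrite !mxE eqxx !mulr1n => /eqP.
  by rewrite -expr2 sqrf_eq1 => /orP[]/eqP->; [left | right].
case=> ru; [constructor 2 | constructor 3]; apply: (yd_iso_generators sg s34C cent_s12_4_gen);
  by rewrite ?rs ?ru /= ?oplus_4_s12 ?oplus_4_s34.
Qed.

End Classification.

Theorem theorem2p8 (R : realType) (omega4 : R[i]) (omega4P : 4.-primitive_root omega4) :
  (forall (s : 'S_3) (d : nat) (rho : mx_representation R[i] 'C[s]%G d),
     mx_irreducible rho -> nichols_irr_finite_dim rho ->
     yd_iso (yd_irr rho) (yd_irr (rep_sgn_3 _)))
  /\
  (forall (s : 'S_4) (d : nat) (rho : mx_representation R[i] 'C[s]%G d),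
     mx_irreducible rho -> nichols_irr_finite_dim rho ->
     [\/ yd_iso (yd_irr rho) (yd_irr (rep_chi4_sqr omega4P)),
         yd_iso (yd_irr rho) (yd_irr (rep_sgn_eps_4 _))
       | yd_iso (yd_irr rho) (yd_irr (rep_sgn_sgn_4 _))]).
Proof.
have char0 : [pchar R[i]] =i pred0 by apply: Num.Theory.pchar_num.
split=> s d rho; first exact: (S3_classification char0).
exact: (S4_classification char0).
Qed.
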